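(* Let $b = \log 2 - \int_0^\infty \log\left(1 - 2^{-e^{y}}\right) dy$. For $p \in (0,1)$, let $N = N^{(p)}$ be the minimal number of samples needed to form the first block of a $\mathrm{Geo}(p)$-biased permutation of the positive integers. Then $p \log\log N \to b$ in probability as $p \to 0$.
   Context: $\mathrm{Geo}(p)$ denotes the geometric distribution on $\{1,2,\dots\}$ with mass $p(1-p)^{j-1}$ at $j$. Let $X_1, X_2, \dots$ be i.i.d. $\mathrm{Geo}(p)$ random variables. The $\mathrm{Geo}(p)$-biased permutation is the map $i \mapsto \Pi_i$, where $(\Pi_1, \Pi_2, \dots)$ is the sequence of distinct values of $(X_1, X_2, \dots)$ in order of appearance (almost surely every positive integer appears). Write $[k] = \{1,\dots,k\}$. The block size is $K = \inf\{k \ge 1 : \Pi([k]) = [k]\}$ (almost surely finite for this distribution), and $N$ is the minimal integer $n \geq 1$ such that $\{X_1, \dots, X_n\} = [K]$. Convention: $\log\log N = -\infty$ when $N = 1$. Numerically $b \approx 1.1524$. *)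

(* Defs.v *)
From HB Require Import structures.
From mathcomp Require Import all_boot all_order all_algebra.
From mathcomp Require Import all_classical all_reals all_analysis.

Set Implicit Arguments.
Unset Strict Implicit.
Unset Printing Implicit Defensive.

Import Order.TTheory GRing.Theory Num.Theory.
Import numFieldNormedType.Exports.

Local Open Scope classical_set_scope.
Local Open Scope ring_scope.

Definition geometric_pmf {R : realType} (p : R) (j : nat) : R :=
  if j is k.+1 then p * (1 - p) ^+ k else 0.

Definition mutually_independent {R : realType} {I : eqType}
    {d d' : measure_display} {T : measurableType d} {T' : measurableType d'}
    (P : probability T R) (X : I -> {RV P >-> T'}) : Prop :=
  forall (J : seq I) (B : I -> set T'), uniq J ->
    (forall i, measurable (B i)) ->
    P (\bigcap_(i in [set` J]) (X i @^-1` B i)) =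
    (\prod_(i <- J) P (X i @^-1` B i))%E.

Definition iid_geometric {R : realType} {d : measure_display}
    {T : measurableType d} (P : probability T R) (p : R)
    (X : nat -> {RV P >-> nat}) : Prop :=
  mutually_independent X /\
  forall i j : nat, distribution P (X i) [set j] = (geometric_pmf p j)%:E.

(* The sample spaces may vary with the index, and the random variables may take
   infinite values.  The events below have to be measurable for [P i] to be
   their probability. *)
Definition cvg_in_probability {R : realType} {I : Type} (F : set_system I)
    {d : I -> measure_display} {T : forall i, measurableType (d i)}
    (P : forall i, probability (T i) R) (Y : forall i, T i -> \bar R)
    (l : R) : Prop :=
  forall eps : R, 0 < eps ->
    (fun i => P i [set w | (eps%:E <= `|Y i w - l%:E|)%E]) @ F --> 0%E.

(* A sequence of samples is a function [x : nat -> nat] whose value at [n] is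
   the (n+1)-st sample; hence [mkseq x n] lists the first n samples. *)

(* The i-th distinct value of x in order of appearance, for i >= 1.  It is 0,
   which is not a positive integer, if x has fewer than i distinct values. *)
Definition discovered (x : nat -> nat) (i : nat) : nat :=
  xget 0%N [set v | exists m : nat,
    [/\ x m = v, v \notin mkseq x m & (size (undup (mkseq x m))).+1 = i]].

Definition segment (k : nat) : set nat := [set j | (1 <= j <= k)%N].

(* Equal to +oo when no block is ever completed. *)
Definition block_size (R : realType) (x : nat -> nat) : \bar R :=
  ereal_inf [set k%:R%:E | k in
    [set k : nat | (1 <= k)%N /\ discovered x @` segment k = segment k]].

Definition esegment {R : realType} (K : \bar R) : set nat :=
  [set j | (1 <= j)%N /\ (j%:R%:E <= K)%E].

(* Equal to +oo when [block_size R x] is. *)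
Definition block_samples (R : realType) (x : nat -> nat) : \bar R :=
  ereal_inf [set n%:R%:E | n in
    [set n : nat | (1 <= n)%N /\ [set` mkseq x n] = esegment (block_size R x)]].

Definition limit_constant (R : realType) : R :=
  ln 2 - \int[@lebesgue_measure R]_(y in `[0, +oo[) ln (1 - 2 `^ (- expR y)).

(* Main.v *)
Require Import Defs.
From mathcomp Require Import all_boot all_order all_algebra.
From mathcomp Require Import all_classical all_reals all_analysis.
From mathcomp Require Import measurable_realfun.
From mathcomp Require Import zify ring lra.

Set Implicit Arguments.
Unset Strict Implicit.
Unset Printing Implicit Defensive.

Import Order.TTheory GRing.Theory Num.Theory.
Import numFieldNormedType.Exports.

Local Open Scope classical_set_scope.
Local Open Scope ring_scope.

(** Write [q = 1 - p] and [b] for [limit_constant]. The first block is complete as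
    soon as the set of the samples seen so far is some segment [1..k]
    ([block_samples_cases]). So the question is how likely it is that all of [1..k]
    appear before any larger value, and how many [k] must be tried.

    This probability is an integral over Poissonized time. The probability that the
    first [n] samples stay in a set of mass [x] and hit all of a list of values is an
    iterated difference of [x ^+ n], by inclusion-exclusion ([pr_fill_cyl]). Summed
    over [n] it becomes the same difference of [1 / (1 - x)], the integral of a product
    over independent exponential clocks ([total_le], [total_ge]). In the variable [c],
    equal to [p] times time in units where values above [k] have rate 1, the integrand
    is [expR (- (c / p))] times the product over [i >= 1] of
    [1 - expR (- (c / q ^+ i))], one factor per value among the top ones of [1..k]: see
    [profile]. It does not depend on [k] except through the number of factors.

    Replacing [c] by [q * c] shifts the product by one factor and multiplies the whole
    by [expR c - 1] ([profile_shift]). Hence the maximum lies within a factor [q] of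
    [c = ln 2], where the exponential gives [expR (- (ln 2 / p))] and the logarithm of
    the product is a Riemann sum, of mesh [- ln q] close to [p], for the integral in
    [b] ([optimal_product_ge], [optimal_product_le]). So the probability is
    [expR (- (b + o(1)) / p)] for large [k] ([block_mass_upper], [block_mass_ge]).

    The maximum of [n] samples is of order [ln n / p]. If a block is complete by time
    [expR (expR ((b - e) / p))], then one of about [expR ((b - e) / p)] segments, up to
    powers of [p], was filled before any larger value. A union bound over these
    segments is small ([pr_early_le], [early_tail]); small [k], where the probability
    is only polynomially small in [p], are treated apart ([block_mass1],
    [block_mass4_le]).

    Conversely, cut the samples into consecutive windows, window [i] aiming at a
    segment [1..k_i] with [k_i] growing linearly in [i]. Whether the window alone sees
    all of [1..k_i] before any larger value is independent from window to window, and
    earlier samples, being far fewer, rarely exceed [k_i]. After [expR (b / p) / p]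
    windows some trial succeeds, and the window lengths grow only exponentially in [i],
    so [p] times the double logarithm of the time spent is [b] in the limit
    ([pr_late_le], [late_tail]). *)

(** * Riemann sums of nonincreasing functions *)

Section Riemann_sums.
Variables (R : realType) (f : R -> R).
Hypotheses (f_ge0 : forall x, 0 <= f x) (f_mono : forall x y, x <= y -> f y <= f x).
Local Notation leb := (@lebesgue_measure R).

Lemma measurable_nonincreasing (D : set R) (mD : measurable D) :
  measurable_fun D (fun x => (f x)%:E).
Proof. apply/measurable_EFinP; apply: nonincreasing_measurable => // x y;
  exact: f_mono. Qed.

Lemma integral_step (a b : R) : a <= b ->
  (((b - a) * f b)%:E <= \int[leb]_(x in `[a, b[) (f x)%:E <=
   ((b - a) * f a)%:E)%E.
Proof.
move=> ab.
have cstE c : (\int[leb]_(x in `[a, b[) c%:E = ((b - a) * c)%:E)%E.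
  rewrite integral_cst//= lebesgue_measure_itv/= lte_fin.
  case: ltP => ba; first by rewrite -EFinD -EFinM mulrC.
  by have -> : b = a by [apply/eqP; rewrite eq_le ab ba]; rewrite subrr mul0r mule0.
have mfab := measurable_nonincreasing (measurable_itv `[a, b[).
rewrite -!cstE; apply/andP; split; apply: ge0_le_integral => //=.
- by move=> x _; rewrite lee_fin.
- by move=> x; rewrite in_itv/= => /andP[_ /ltW xb]; rewrite lee_fin f_mono.
- by move=> x _; rewrite lee_fin.
- by move=> x; rewrite in_itv/= => /andP[ax _]; rewrite lee_fin f_mono.
Qed.

Lemma integral_split (a b c : R) : a <= b -> b <= c ->
  (\int[leb]_(x in `[a, c[) (f x)%:E = \int[leb]_(x in `[a, b[) (f x)%:E
     + \int[leb]_(x in `[b, c[) (f x)%:E)%E.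
Proof.
move=> ab bc; rewrite -ge0_integral_setU//=.
- rewrite -(@itv_bndbnd_setU _ _ (BLeft a) (BLeft b) (BLeft c))//.
- apply: measurable_nonincreasing; exact: measurableU.
- by move=> x _; rewrite lee_fin.
- apply/disj_setPS => x [] /=; rewrite !in_itv/= => /andP[_ xb] /andP[bx _].
  by move: (lt_le_trans xb bx); rewrite ltxx.
Qed.

Lemma Riemann_bounds (h : R) k : 0 <= h ->
  ((h * \sum_(i < k) f (i.+1%:R * h)%R)%:E
     <= \int[leb]_(x in `[0%R, (k%:R * h)%R[) (f x)%:E <=
   (h * \sum_(i < k) f (i%:R * h)%R)%:E)%E.
Proof.
move=> h0; elim: k => [|k /andP[lo hi]].
  by rewrite !big_ord0 mul0r mulr0 set_itvco0 integral_set0 lexx.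
have kh : k%:R * h <= k.+1%:R * h by rewrite ler_wpM2r// ler_nat.
rewrite !big_ord_recr/= !mulrDr (@integral_split _ (k%:R * h))//; last first.
  by rewrite mulr_ge0.
have := integral_step kh; rewrite -mulrBl -natrB// subSnn mul1r => /andP[lo' hi'].
by rewrite !EFinD; apply/andP; split; exact: leeD.
Qed.

Lemma Riemann_sum_le_integral (h : R) k : 0 <= h ->
  leb.-integrable `[0, +oo[ (EFin \o f) ->
  h * \sum_(i < k) f (i.+1%:R * h) <= \int[leb]_(x in `[0, +oo[) f x.
Proof.
move=> h0 intf.
have [lo _] := andP (Riemann_bounds k h0).
rewrite -lee_fin /Rintegral fineK; last exact: integrable_fin_num.
apply: le_trans lo _; apply: ge0_subset_integral => //=.
- exact: measurable_nonincreasing.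
- by move=> x _; rewrite lee_fin.
- by move=> x; rewrite /= !in_itv/= => /andP[->].
Qed.

(** The integral over a large interval [0, i + 1] already exceeds the whole one
    minus [e]; beyond it the Riemann sum only grows, so one threshold serves
    every mesh [h]. *)
Lemma integral_le_Riemann_sum (e : R) : 0 < e ->
  leb.-integrable `[0, +oo[ (EFin \o f) ->
  exists Y : R, forall (h : R) k, 0 <= h -> Y <= k%:R * h ->
    \int[leb]_(x in `[0, +oo[) f x - e <= h * \sum_(i < k) f (i%:R * h).
Proof.
move=> e0 intf; set I := Rintegral _ _ _.
have IE : I%:E = (\int[leb]_(x in `[0%R, +oo[) (f x)%:E)%E.
  by rewrite /I /Rintegral fineK//; exact: integrable_fin_num.
have mT : measurable_fun [set: measurableTypeR R] f.
  by apply: nonincreasing_measurable => // x y; exact: f_mono.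
have := IE; rewrite (ge0_integral_ereal_sup _ f_ge0 mT) => /esym supE.
have : ((I - e)%:E < I%:E)%E by rewrite lte_fin ltrBlDr ltrDl.
rewrite -supE => /ereal_sup_gt[_ [i _ <-]] lt_e.
exists (i.+2%:R) => h k h0 Yk; rewrite -lee_fin.
have [_ hi] := andP (Riemann_bounds k h0).
apply: le_trans hi; apply: (le_trans (ltW lt_e)).
apply: ge0_subset_integral => //=.
- exact: measurable_nonincreasing.
- by move=> x _; rewrite lee_fin.
- move=> x; rewrite /= !in_itv/= => /andP[-> xi]/=.
  by rewrite (lt_le_trans _ Yk)// (le_lt_trans xi)// ltr_nat.
Qed.

End Riemann_sums.

(** * The limit constant and its Riemann sums *)

Section cost.
Variable R : realType.
Implicit Types x y : R.

(** The price, on a logarithmic scale, of seeing an exponential clock ring before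
    time [x]. *)
Definition cost x : R := - ln (1 - expR (- x)).

Lemma expRN_bounds x : 0 < x -> 0 < 1 - expR (- x) < 1.
Proof.
move=> x0; rewrite subr_gt0 -expR0 ltr_expR oppr_lt0 x0/= expR0.
by rewrite ltrBlDr ltrDl expR_gt0.
Qed.

Lemma expR_cost x : 0 < x -> expR (- cost x) = 1 - expR (- x).
Proof. by move=> /expRN_bounds /andP[? _]; rewrite opprK lnK ?posrE. Qed.

Lemma cost_ge0 x : 0 < x -> 0 <= cost x.
Proof.
by move=> /expRN_bounds /andP[_ /ltW x1]; rewrite oppr_ge0 ln_le0.
Qed.

Lemma cost_mono x y : 0 < x -> x <= y -> cost y <= cost x.
Proof.
move=> x0 xy; have y0 := lt_le_trans x0 xy.
have [/andP[x1 _] /andP[y1 _]] := (expRN_bounds x0, expRN_bounds y0).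
by rewrite lerN2 ler_ln ?posrE// lerB// ler_expR lerN2.
Qed.

Lemma ln2_gt0 : 0 < ln 2 :> R.
Proof. by rewrite ln_gt0// ltr1n. Qed.

Lemma expRN_ln2 : expR (- ln 2) = 2^-1 :> R.
Proof. by rewrite expRN lnK// posrE. Qed.

(** The fixed point [ln 2] of [cost] is the critical point of the Laplace
    exponent, and the source of the [ln 2] in [limit_constant]. *)
Lemma cost_ln2 : cost (ln 2) = ln 2.
Proof.
rewrite /cost expRN_ln2; have -> : 1 - 2^-1 = 2^-1 :> R by lra.
by rewrite lnV ?opprK// posrE.
Qed.

Lemma cost_le_expR x : ln 2 <= x -> cost x <= 2 * expR (- x).
Proof.
move=> x2; have x0 := lt_le_trans ln2_gt0 x2.
have /andP[u0 u1] := expRN_bounds x0.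
have e2 : expR (- x) <= 2^-1 by rewrite -expRN_ln2 ler_expR lerN2.
rewrite /cost -lnV ?posrE//.
have e0 := expR_gt0 (- x); set u := expR (- x) in u0 u1 e2 e0 *.
have -> : (1 - u)^-1 = 1 + u / (1 - u) by field; lra.
apply: le_trans (le_ln1Dx _) _.
  by apply: (@lt_le_trans _ _ 0) => //; rewrite divr_ge0 ?ltW.
rewrite ler_pdivrMr//; nra.
Qed.

(** The integrand of [limit_constant], up to sign. *)
Definition optimal_cost y : R := cost (ln 2 * expR y).

Lemma optimal_arg_gt0 y : 0 < ln 2 * expR y.
Proof. by rewrite mulr_gt0 ?ln2_gt0 ?expR_gt0. Qed.

Lemma optimal_cost_ge0 y : 0 <= optimal_cost y.
Proof. exact: cost_ge0 (optimal_arg_gt0 y). Qed.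

Lemma optimal_cost_mono x y : x <= y -> optimal_cost y <= optimal_cost x.
Proof.
by move=> xy; apply: cost_mono (optimal_arg_gt0 x) _;
  rewrite ler_wpM2l ?ler_expR// ltW// ln2_gt0.
Qed.

(** As [expR y] is at least [1 + y], the integrand decays like [2 `^ (- y)]; this
    domination is what makes the integral finite. *)
Lemma optimal_cost_le y : 0 <= y ->
  optimal_cost y <= (ln 2)^-1 * exponential_pdf (ln 2) y.
Proof.
move=> y0; rewrite exponential_pdfE// mulrA mulVf ?mul1r ?gt_eqF ?ln2_gt0//.
have l0 := ln2_gt0; have e1 := expR_ge1Dx y.
have ge : ln 2 + ln 2 * y <= ln 2 * expR y.
  by rewrite -{1}[ln 2]mulr1 -mulrDr ler_wpM2l// ltW.
apply: le_trans (cost_le_expR _) _; first by apply: le_trans ge;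
  rewrite lerDl mulr_ge0// ltW.
apply: (@le_trans _ _ (2 * expR (- ln 2 - ln 2 * y))).
  by rewrite ler_pM2l// ler_expR; lra.
by rewrite expRD expRN_ln2 mulrA divff// mul1r mulNr.
Qed.

Lemma integrable_optimal_cost :
  (@lebesgue_measure R).-integrable `[0, +oo[ (EFin \o optimal_cost).
Proof.
have intg : (@lebesgue_measure R).-integrable `[0, +oo[
    (fun y => ((ln 2)^-1)%:E * (EFin \o exponential_pdf (ln 2)) y)%E.
  apply: integrableZl => //; apply: (@integrableS _ _ _ _ setT) => //.
  exact/integrable_exponential_pdf/ln2_gt0.
apply: le_integrable intg => //;
  first exact: measurable_nonincreasing optimal_cost_mono _ _.
move=> y; rewrite /= in_itv/= andbT => y0.
rewrite ger0_norm ?optimal_cost_ge0// ger0_norm.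
  by rewrite lee_fin optimal_cost_le.
by rewrite mulr_ge0// ?invr_ge0 ?exponential_pdf_ge0// ltW// ln2_gt0.
Qed.

Definition cost_integral : R := \int[@lebesgue_measure R]_(y in `[0, +oo[) optimal_cost y.

Lemma cost_integral_ge0 : 0 <= cost_integral.
Proof. by apply: Rintegral_ge0 => y _; exact: optimal_cost_ge0. Qed.

Lemma limit_constantE : limit_constant R = ln 2 + cost_integral.
Proof.
rewrite /limit_constant -[in RHS](opprK cost_integral); congr (_ - _).
rewrite -mulN1r -RintegralZl//; last exact: integrable_optimal_cost.
apply: eq_Rintegral => y _; rewrite mulN1r opprK /powR.
by rewrite gt_eqF// mulNr mulrC.
Qed.

End cost.

Section optimal_product.
Variables (R : realType) (p : R).
Hypothesis p01 : 0 < p < 1.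
Local Notation q := (1 - p).
Local Notation h := (- ln q).

Let q01 : 0 < q < 1. Proof. by case/andP: p01 => *; apply/andP; split; lra. Qed.

(** The mesh of the Riemann sums is [- ln (1 - p)], because the powers of [1 - p]
    are equally spaced on a logarithmic scale; this and the next lemma compare it
    with [p]. *)
Lemma le_lograte : p <= h.
Proof.
have [q0 _] := andP q01; have [_ p1] := andP p01.
by rewrite lerNr le_ln1Dx//; lra.
Qed.

Lemma lograte_le : q * h <= p.
Proof.
have [q0 _] := andP q01; rewrite -lnV ?posrE//.
have -> : q^-1 = 1 + p / q by field; lra.
rewrite mulrC -ler_pdivlMr//; apply: le_ln1Dx.
by apply: (@lt_le_trans _ _ 0) => //; rewrite divr_ge0 ?ltW//; case/andP: p01.
Qed.

Lemma optimal_factor i :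
  1 - expR (- (ln 2 * q^-1 ^+ i)) = expR (- optimal_cost (i%:R * h)) :> R.
Proof.
have [q0 _] := andP q01.
rewrite expR_cost ?optimal_arg_gt0//; congr (1 - expR (- (_ * _))).
by rewrite expRM_natl expRN lnK// posrE.
Qed.

Lemma optimal_product_ge m :
  expR (- (cost_integral R / p)) <=
  \prod_(i < m) (1 - expR (- (ln 2 * q^-1 ^+ i.+1))).
Proof.
have [p0 _] := andP p01; have ph := le_lograte.
under eq_bigr do rewrite optimal_factor.
rewrite -expR_sum ler_expR sumrN lerN2 ler_pdivlMr//.
have h0 : 0 <= h by apply: le_trans ph; exact: ltW.
apply: le_trans (Riemann_sum_le_integral (@optimal_cost_ge0 R)
  (@optimal_cost_mono R) m h0 (integrable_optimal_cost R)).
rewrite mulrC ler_wpM2r// sumr_ge0// => i _; exact: optimal_cost_ge0.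
Qed.

End optimal_product.

(** The sum starts at index 1, so the term of index 0 of the Riemann sum, which is
    [ln 2] by [cost_ln2], is lost: hence the factor 2. The factor
    [expR cost_integral] pays for replacing the mesh by [p]. *)
Lemma optimal_product_le (R : realType) (e : R) : 0 < e -> exists Y : R,
  forall p : R, 0 < p < 1 -> forall m, Y <= m%:R * p ->
  \prod_(i < m) (1 - expR (- (ln 2 * (1 - p)^-1 ^+ i.+1))) <=
  2 * expR (cost_integral R) * expR (- ((cost_integral R - e) / p)).
Proof.
move=> e0; have [Y HY] := integral_le_Riemann_sum (@optimal_cost_ge0 R)
  (@optimal_cost_mono R) e0 (integrable_optimal_cost R).
exists Y => p p01 m Ym; have [p0 p1] := andP p01.
have ph := le_lograte p01; have hp := lograte_le p01.
set h := - ln (1 - p) in ph hp.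
have h0 : 0 < h by exact: lt_le_trans p0 ph.
have Yh : Y <= m.+1%:R * h.
  apply: le_trans Ym _; rewrite ler_pM// ?ler_nat// ltW//.
pose S := \sum_(i < m) optimal_cost (i.+1%:R * h).
have -> : \prod_(i < m) (1 - expR (- (ln 2 * (1 - p)^-1 ^+ i.+1))) = expR (- S).
  rewrite /S -sumrN expR_sum; apply: eq_bigr => i _; exact: optimal_factor.
set I := cost_integral R.
have I0 : 0 <= I by exact: cost_integral_ge0.
have IS : I - e <= h * (ln 2 + S).
  have := HY h m.+1 (ltW h0) Yh; rewrite big_ord_recl/= mul0r.
  by rewrite [optimal_cost 0]/optimal_cost expR0 mulr1 cost_ln2.
have -> : 2 = expR (ln 2) :> R by rewrite lnK// posrE.
rewrite -!expRD ler_expR.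
suff : (I - e) / p - I <= ln 2 + S by lra.
have hV : h^-1 <= p^-1 by rewrite lef_pV2 ?posrE.
have hV' : (1 - p) / p <= h^-1.
  by rewrite ler_pdivrMr// -(ler_pM2l h0) mulrA mulfV ?gt_eqF// mul1r mulrC.
apply: (@le_trans _ _ ((I - e) / h)); last by rewrite ler_pdivrMr// mulrC.
have -> : (I - e) / p - I = I * ((1 - p) / p) - e * p^-1.
  by field; rewrite gt_eqF.
by rewrite [leRHS]mulrBl lerB// ler_wpM2l// ltW.
Qed.

(** * The Laplace profile *)

Section profile.
Variables (R : realType) (p : R).
Hypothesis p01 : 0 < p < 1.
Local Notation q := (1 - p).
Implicit Types c : R.

(** The probability, at the rescaled Poisson time [c], that the [m] largest values of
    an initial segment have all appeared and nothing larger has. The expected number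
    of arrivals is [c / (1 - p)] for the largest of these values, [c / (1 - p) ^+ 2]
    for the next one, and so on; it is [c / p] for all larger values together. *)
Definition profile m c : R :=
  expR (- (c / p)) * \prod_(i < m) (1 - expR (- (c * q^-1 ^+ i.+1))).

Let p0 : 0 < p. Proof. by case/andP: p01. Qed.
Let q0 : 0 < q. Proof. by case/andP: p01 => *; lra. Qed.
Let q1 : q < 1. Proof. by case/andP: p01 => *; lra. Qed.

Let arg_gt0 c i : 0 < c -> 0 < c * q^-1 ^+ i.
Proof. by move=> c0; rewrite mulr_gt0// exprn_gt0// invr_gt0. Qed.

Let factor_ge0 c i : 0 < c -> 0 <= 1 - expR (- (c * q^-1 ^+ i)).
Proof. by move=> /(arg_gt0 i)/expRN_bounds/andP[/ltW]. Qed.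

Let factor_le1 c i : 0 < c -> 1 - expR (- (c * q^-1 ^+ i)) <= 1.
Proof. by move=> /(arg_gt0 i)/expRN_bounds/andP[_ /ltW]. Qed.

Lemma profile_ge0 m c : 0 < c -> 0 <= profile m c.
Proof.
move=> c0; rewrite mulr_ge0 ?expR_ge0// prodr_ge0// => i _; exact: factor_ge0.
Qed.

Lemma profile_anti m n c : 0 < c -> (m <= n)%N -> profile n c <= profile m c.
Proof.
move=> c0 /subnKC <-; rewrite /profile ler_wpM2l ?expR_ge0//.
rewrite big_split_ord/= ler_piMr//.
  by apply: prodr_ge0 => i _; exact: factor_ge0.
by apply: Num.Theory.prodr_ile1 => i _; rewrite factor_ge0 ?factor_le1.
Qed.

(** Scaling [c] by [1 - p] shifts the product by one index. The ratio [expR c - 1]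
    crosses 1 at [c = ln 2]: this is the discrete form of the Laplace critical
    point, and it replaces any differentiation of the exponent. *)
Lemma profile_shift m c : 0 < c ->
  profile m.+1 (q * c) = (expR c - 1) * profile m c.
Proof.
move=> c0; rewrite /profile big_ord_recl/=.
have -> : - (q * c / p) = - (c / p) + c by field; rewrite gt_eqF.
have -> : q * c * q^-1 ^+ 1 = c by field; rewrite gt_eqF.
have -> : \prod_(i < m) (1 - expR (- (q * c * q^-1 ^+ (bump 0 i).+1))) =
    \prod_(i < m) (1 - expR (- (c * q^-1 ^+ i.+1))).
  apply: eq_bigr => i _; rewrite /bump add1n [in LHS]exprS mulrACA.
  by rewrite mulrV ?unitfE ?gt_eqF// mul1r.
have -> : expR c - 1 = expR c * (1 - expR (- c)).
  by rewrite mulrBr mulr1 -expRD subrr expR0.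
by rewrite expRD; ring.
Qed.

Lemma profile_shrink m c : ln 2 <= c -> profile m c <= profile m (q * c).
Proof.
move=> c2; have c0 := lt_le_trans (ln2_gt0 R) c2.
have qc0 : 0 < q * c by rewrite mulr_gt0.
apply: le_trans (profile_anti qc0 (leqnSn m));
  rewrite profile_shift// ler_peMl ?profile_ge0//.
have : expR (ln 2) <= expR c by rewrite ler_expR.
by rewrite lnK ?posrE//; lra.
Qed.

Lemma profile_grow m c : 0 < c -> c <= ln 2 ->
  profile m.+1 (q * c) <= profile m c.
Proof.
move=> c0 c2; rewrite profile_shift// ler_piMl ?profile_ge0//.
have : expR c <= expR (ln 2) by rewrite ler_expR.
by rewrite lnK ?posrE//; lra.
Qed.

(** Bounds [profile m] on the whole interval from [(1 - p) * ln 2] to [ln 2]: the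
    exponential is taken at the left end and the product at the right end. *)
Definition profile_cap m : R := expR (- (q * ln 2 / p)) *
  \prod_(i < m) (1 - expR (- (ln 2 * q^-1 ^+ i.+1))).

Lemma profile_cap_ge0 m : 0 <= profile_cap m.
Proof.
rewrite mulr_ge0 ?expR_ge0// prodr_ge0// => i _; exact/factor_ge0/ln2_gt0.
Qed.

Let ql0 : 0 < q * ln 2. Proof. by rewrite mulr_gt0// ln2_gt0. Qed.

Lemma profile_le_cap_window m c : q * ln 2 <= c -> c <= ln 2 ->
  profile m c <= profile_cap m.
Proof.
move=> cl cr; have c0 : 0 < c := lt_le_trans ql0 cl.
rewrite /profile /profile_cap ler_pM ?expR_ge0//.
- by apply: prodr_ge0 => i _; exact: factor_ge0.
- by rewrite ler_expR lerN2 ler_wpM2r// invr_ge0 ltW.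
- apply: ler_prod => i _; rewrite factor_ge0//= lerB// ler_expR lerN2.
  by rewrite ler_wpM2r// exprn_ge0// invr_ge0 ltW.
Qed.

(** Descend from [c] by factors [1 - p] until [ln 2] is crossed; no step
    decreases the profile. *)
Lemma profile_le_cap_large m c : q * ln 2 <= c -> profile m c <= profile_cap m.
Proof.
have [t] : exists t, c * q ^+ t <= ln 2.
  have : (fun t => c * q ^+ t) @ \oo --> c * 0.
    by apply: cvgMr; apply: cvg_expr; rewrite ger0_norm ?ltW.
  rewrite mulr0 => /cvgr_le /(_ _ (ln2_gt0 R)) [t _ H].
  by exists t; apply: H => /=.
elim: t c => [|t IH] c; first by rewrite expr0 mulr1 => *; exact: profile_le_cap_window.
move=> ct cl; have [c2|/ltW c2] := leP c (ln 2); first exact: profile_le_cap_window.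
apply: le_trans (profile_shrink _ c2) _; apply: IH; last by rewrite ler_wpM2l// ltW.
by rewrite -mulrA mulrCA -exprS.
Qed.

(** Ascending from [c] to [ln 2] costs one factor of the product per step, so [t]
    spare factors allow to start from [(1 - p) ^+ t * ln 2]. *)
Lemma profile_le_cap_small m t c : q ^+ t * ln 2 <= c ->
  profile (m + t) c <= profile_cap m.
Proof.
elim: t c => [|t IH] c.
  rewrite expr0 mul1r addn0 => c2; apply: profile_le_cap_large; apply: le_trans c2.
  by rewrite ler_piMl ?ltW// ln2_gt0.
move=> ct; have [cq|cq] := leP (q * ln 2) c.
  apply: le_trans (profile_le_cap_large m cq); apply: profile_anti; last exact: leq_addr.
  exact: lt_le_trans ql0 cq.
have cE : c = q * (c / q) by field; rewrite gt_eqF.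
rewrite addnS cE; apply: le_trans (profile_grow _ _ _) _.
- rewrite divr_gt0//; apply: lt_le_trans ct.
  by rewrite mulr_gt0 ?ln2_gt0// exprn_gt0.
- by rewrite ler_pdivrMr// mulrC ltW.
- by apply: IH; rewrite ler_pdivlMr// mulrAC -exprSr.
Qed.

(** Half of the factors serve to climb to [ln 2]. For the [c] that are too small to
    climb, the product is monotone in [c] and the exponential is close to 1. *)
Lemma profile_le_cap m c : 0 < c ->
  profile (m + m) c <= expR (q ^+ m * ln 2 / p) * profile_cap m.
Proof.
move=> c0; set d := q ^+ m * ln 2.
have d0 : 0 < d by rewrite mulr_gt0 ?ln2_gt0// exprn_gt0.
have [dc|/ltW cd] := leP d c.
  apply: le_trans (profile_le_cap_small _ dc) _.
  rewrite ler_peMl ?profile_cap_ge0// -expR0 ler_expR; exact/ltW/divr_gt0.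
apply: (@le_trans _ _ (expR (d / p) * profile (m + m) d)); last first.
  by rewrite ler_wpM2l ?expR_ge0// profile_le_cap_small.
rewrite /profile mulrA -expRD subrr expR0 ler_pM ?expR_ge0//.
- by apply: prodr_ge0 => i _; exact: factor_ge0.
- by rewrite -expR0 ler_expR oppr_le0 ltW// divr_gt0.
- apply: ler_prod => i _; rewrite factor_ge0//= lerB// ler_expR lerN2.
  by rewrite ler_wpM2r// exprn_ge0// invr_ge0 ltW.
Qed.

(** The window from [ln 2] to [ln 2 / (1 - p)] is short enough for the profile to be
    nearly constant on it, yet wide enough to carry the integral. *)
Lemma profile_ge_window m c : ln 2 <= c -> c <= ln 2 / q ->
  expR (- (ln 2 / (p * q))) * expR (- (cost_integral R / p)) <= profile m c.
Proof.
move=> c2 cq; have c0 := lt_le_trans (ln2_gt0 R) c2.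
rewrite /profile ler_pM ?expR_ge0//.
  rewrite ler_expR lerN2 invfM (mulrC p^-1) mulrA.
  by rewrite ler_wpM2r// invr_ge0 ltW.
apply: le_trans (optimal_product_ge p01 m) _.
apply: ler_prod => i _; rewrite factor_ge0 ?ln2_gt0//= lerB// ler_expR lerN2.
by rewrite ler_wpM2r// exprn_ge0// invr_ge0 ltW.
Qed.

End profile.

(** * Iterated differences and Poissonization *)

Section iterated_difference.
Variable R : realType.
Implicit Types (J : seq R) (x s : R).

(** Inclusion-exclusion over the sums of sublists of [J], arranged as a recursion. *)
Fixpoint bdiff J (f : R -> R) x : R :=
  if J is a :: J' then bdiff J' f x - bdiff J' f (x - a) else f x.

(** After Poissonization at time [s], with [x] the total mass of the allowed values:
    no forbidden value has appeared, and every value with mass in [J] has. The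
    factors are independent, which is the point of Poissonization. *)
Definition fill_prob J x s : R :=
  expR (- ((1 - x) * s)) * \prod_(a <- J) (1 - expR (- (a * s))).

Lemma bdiff_expR J x s :
  bdiff J (fun x => expR (- ((1 - x) * s))) x = fill_prob J x s.
Proof.
rewrite /fill_prob; elim: J x => [|a J IH] x /=; first by rewrite big_nil mulr1.
rewrite !IH big_cons.
have -> : - ((1 - (x - a)) * s) = - ((1 - x) * s) + - (a * s) by ring.
by rewrite expRD; ring.
Qed.

(** Antiderivative in [s] of [fill_prob J x]; an explicit one exists because
    inclusion-exclusion turns the product into a combination of exponentials. *)
Definition fill_prob_primitive J s :=
  bdiff J (fun x => - (expR (- ((1 - x) * s)) / (1 - x))).

Lemma fill_prob_primitive0 J x : fill_prob_primitive J 0 x = - bdiff J (fun x => (1 - x)^-1) x.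
Proof.
rewrite /fill_prob_primitive; elim: J x => [|a J IH] x /=.
  by rewrite mulr0 oppr0 expR0 mul1r.
by rewrite !IH; ring.
Qed.

Lemma is_derive_fill_prob_primitive J x s : {in J, forall a, 0 <= a} -> x < 1 ->
  is_derive s 1 (fill_prob_primitive J ^~ x) (fill_prob J x s).
Proof.
move=> + x1; rewrite -bdiff_expR /fill_prob_primitive.
elim: J x x1 => [|a J IH] x x1 J0 /=.
  apply: is_derive_eq; rewrite /GRing.scale/= mulr1; field.
  by rewrite subr_eq0 gt_eqF.
have J0' : {in J, forall b, 0 <= b}.
  by move=> b bJ; apply: J0; rewrite inE bJ orbT.
apply: is_deriveB; apply: IH => //.
by apply: le_lt_trans x1; rewrite gerBl J0// mem_head.
Qed.

Lemma cvg_fill_prob_primitive J x s : {in J, forall a, 0 <= a} -> x < 1 ->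
  fill_prob_primitive J (s + n%:R) x @[n --> \oo] --> (0 : R).
Proof.
rewrite /fill_prob_primitive; elim: J x => [|a J IH] x J0 x1 /=.
  rewrite (_ : (fun n => _) = (fun n =>
    (- (expR (- ((1 - x) * s)) / (1 - x))) * (expR (- (1 - x))) ^+ n)).
    rewrite -[X in _ --> X](mulr0 (- (expR (- ((1 - x) * s)) / (1 - x)))).
    apply: cvgMr; apply: cvg_expr; rewrite ger0_norm ?expR_ge0//.
    by rewrite expR_lt1 oppr_lt0 subr_gt0.
  apply/funext => n; rewrite -expRM_natl mulNr mulrAC -expRD.
  by congr (- (expR _ / _)); ring.
have J0' : {in J, forall b, 0 <= b}.
  by move=> b bJ; apply: J0; rewrite inE bJ orbT.
rewrite -[X in _ --> X](subr0 (0 : R)); apply: cvgB; apply: IH => //.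
by apply: le_lt_trans x1; rewrite gerBl J0// mem_head.
Qed.

(** Summing geometric series inside the difference. *)
Lemma cvg_series_bdiff_expn J x : {in J, forall a, 0 <= a} ->
  \sum_(a <- J) a <= x -> x < 1 ->
  (\sum_(n < N) bdiff J (fun x => x ^+ n) x) @[N --> \oo] -->
  bdiff J (fun x => (1 - x)^-1) x.
Proof.
elim: J x => [|a J IH] x J0 /=.
  rewrite big_nil => x0 x1.
  have := @cvg_geometric_series R 1 x; rewrite ger0_norm// div1r => /(_ x1).
  apply: cvg_trans; apply: near_eq_cvg; near=> N.
  rewrite /series/= big_mkord; apply: eq_bigr => n _; by rewrite mul1r.
rewrite big_cons => Jx x1.
have a0 : 0 <= a by rewrite J0// mem_head.
have J0' : {in J, forall b, 0 <= b}.
  by move=> b bJ; apply: J0; rewrite inE bJ orbT.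
under eq_fun do rewrite sumrB.
apply: cvgB; apply: IH => //; first by apply: le_trans Jx; rewrite lerDr.
  by rewrite lerBrDl.
by apply: le_lt_trans x1; rewrite gerBl.
Unshelve. all: by end_near. Qed.

End iterated_difference.

Lemma MVT_everywhere (R : realType) (f df : R -> R) (a b : R) : a < b ->
  (forall s : R, is_derive s 1 f (df s)) ->
  exists2 c, a < c < b & f b - f a = df c * (b - a).
Proof.
move=> ab fdf.
have cf : {within `[a, b], continuous f}.
  by apply: derivable_within_continuous => s _; exact: ex_derive.
have [c] := MVT ab (fun s _ => fdf s) cf.
by rewrite in_itv/=; exists c.
Qed.

Lemma increasing_to_0 (R : realType) (f df : R -> R) (s : R) : 0 <= s ->
  (forall s : R, is_derive s 1 f (df s)) -> (forall s, 0 <= s -> 0 <= df s) ->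
  f (s + n%:R) @[n --> \oo] --> (0 : R) -> f s <= 0.
Proof.
move=> s0 fdf df0 f_cvg.
have mono : {homo (fun n => f (s + n%:R)) : n m / (n <= m)%N >-> n <= m}.
  move=> n m; rewrite leq_eqVlt => /orP[/eqP->//|nm].
  have lt_nm : s + n%:R < s + m%:R by rewrite ltrD2l ltr_nat.
  have [c /andP[nc _]] := MVT_everywhere lt_nm fdf.
  move=> E; rewrite -subr_ge0 E mulr_ge0//; last by rewrite subr_ge0 ltW.
  by apply: df0; apply: le_trans (ltW nc); rewrite addr_ge0.
have := nondecreasing_cvgn_le mono (cvgP _ f_cvg) 0%N.
by rewrite (cvg_lim _ f_cvg)// addr0.
Qed.

Section poissonization.
Variables (R : realType) (J : seq R) (x : R).
Hypotheses (J_ge0 : {in J, forall a, 0 <= a}) (x1 : x < 1).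
Local Notation total := (bdiff J (fun x => (1 - x)^-1) x).

Lemma fill_prob_ge0 s : 0 <= s -> 0 <= fill_prob J x s.
Proof.
move=> s0; rewrite mulr_ge0 ?expR_ge0// big_seq prodr_ge0// => a aJ.
by rewrite subr_ge0 -expR0 ler_expR oppr_le0 mulr_ge0// J_ge0.
Qed.

Lemma fill_prob_le s : 0 <= s -> fill_prob J x s <= expR (- ((1 - x) * s)).
Proof.
move=> s0; rewrite /fill_prob ler_piMr ?expR_ge0// big_seq.
apply: Num.Theory.prodr_ile1 => a aJ.
have a0 := J_ge0 aJ; by rewrite subr_ge0 gerBl expR_ge0 expR_le1 oppr_le0 mulr_ge0.
Qed.

Lemma fill_prob_primitive_le0 s : 0 <= s -> fill_prob_primitive J s x <= 0.
Proof.
move=> s0; apply: (@increasing_to_0 R (fill_prob_primitive J ^~ x) (fill_prob J x)) => //.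
- by move=> t; exact: is_derive_fill_prob_primitive.
- exact: fill_prob_ge0.
- exact: cvg_fill_prob_primitive.
Qed.

Lemma fill_prob_primitive_ge s : 0 <= s ->
  - (expR (- ((1 - x) * s)) / (1 - x)) <= fill_prob_primitive J s x.
Proof.
pose gap t := fill_prob_primitive [::] t x - fill_prob_primitive J t x.
move=> s0; suff : gap s <= 0 by rewrite subr_le0.
have gap_derive (t : R) : is_derive t 1 gap (fill_prob [::] x t - fill_prob J x t).
  by apply: is_deriveB; exact: is_derive_fill_prob_primitive.
have gap_ge0 t : 0 <= t -> 0 <= fill_prob [::] x t - fill_prob J x t.
  move=> t0; rewrite subr_ge0 {2}/fill_prob big_nil mulr1; exact: fill_prob_le.
have gap_cvg : gap (s + n%:R) @[n --> \oo] --> (0 : R).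
  by rewrite -[X in _ --> X](subr0 (0 : R)); apply: cvgB; exact: cvg_fill_prob_primitive.
exact: increasing_to_0 s0 gap_derive gap_ge0 gap_cvg.
Qed.

(** The total is the integral of [fill_prob] over all positive times, that is,
    the increment of [fill_prob_primitive]: bound it by [B] up to time [S], and by the
    exponential factor alone beyond. *)
Lemma total_le (B S : R) : 0 <= S -> (forall s, 0 < s -> fill_prob J x s <= B) ->
  total <= S * B + expR (- ((1 - x) * S)) / (1 - x).
Proof.
rewrite le_eqVlt => /predU1P[<-|S0] HB.
  by rewrite mul0r add0r -lerN2 -fill_prob_primitive0 fill_prob_primitive_ge.
have [c /andP[c0 _]] :=
  MVT_everywhere S0 (fun s => is_derive_fill_prob_primitive s J_ge0 x1).
rewrite fill_prob_primitive0 opprK subr0 => E.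
have H2 := fill_prob_primitive_ge (ltW S0); have H1 := HB _ c0.
have : fill_prob J x c * S <= S * B by rewrite mulrC ler_wpM2l// ltW.
by move: H2 E; lra.
Qed.

Lemma total_ge (B s1 s2 : R) : 0 <= s1 -> s1 < s2 ->
  (forall s, s1 < s < s2 -> B <= fill_prob J x s) ->
  (s2 - s1) * B <= total.
Proof.
move=> s10 s12 HB.
have D := fun s => is_derive_fill_prob_primitive s J_ge0 x1.
have [c /HB cB E] := MVT_everywhere s12 D.
have le0 : fill_prob_primitive J 0 x <= fill_prob_primitive J s1 x.
  move: s10; rewrite le_eqVlt => /predU1P[<-//|s10].
  have [d /andP[d0 _] E'] := MVT_everywhere s10 D.
  by rewrite -subr_ge0 E' mulr_ge0 ?fill_prob_ge0// ?subr0 ltW.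
have prim_s2 := fill_prob_primitive_le0 (le_trans s10 (ltW s12));
  rewrite fill_prob_primitive0 in le0.
have : (s2 - s1) * B <= fill_prob J x c * (s2 - s1).
  by rewrite mulrC ler_wpM2r// subr_ge0 ltW.
by move: E le0 prim_s2; lra.
Qed.

Hypothesis Jx : \sum_(a <- J) a <= x.

Lemma partial_le_total N : (forall n, 0 <= bdiff J (fun x => x ^+ n) x) ->
  \sum_(n < N) bdiff J (fun x => x ^+ n) x <= total.
Proof.
move=> b0; have C := cvg_series_bdiff_expn J_ge0 Jx x1.
rewrite -(cvg_lim _ C)//; apply: nondecreasing_cvgn_le; last exact: cvgP C.
by apply/nondecreasing_seqP => n; rewrite big_ord_recr lerDl.
Qed.

(** Partial sum plus geometric tail is nonincreasing in [N], and tends to the total. *)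
Lemma total_le_partial N : (forall n, bdiff J (fun x => x ^+ n) x <= x ^+ n) ->
  total <= \sum_(n < N) bdiff J (fun x => x ^+ n) x + x ^+ N / (1 - x).
Proof.
move=> bx; have x0 : 0 <= x by apply: le_trans Jx; rewrite big_seq sumr_ge0.
have C : (\sum_(n < N) bdiff J (fun x => x ^+ n) x + x ^+ N / (1 - x))
    @[N --> \oo] --> total.
  rewrite -[X in _ --> X]addr0; apply: cvgD.
    exact: cvg_series_bdiff_expn.
  rewrite -[X in _ --> X](mul0r (1 - x)^-1); apply: cvgMl.
  by apply: cvg_expr; rewrite ger0_norm.
rewrite -(cvg_lim _ C)//.
apply: (nonincreasing_cvgn_ge (u_ := fun N =>
  \sum_(n < N) bdiff J (fun x => x ^+ n) x + x ^+ N / (1 - x))); last exact: cvgP C.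
apply/nonincreasing_seqP => n; rewrite big_ord_recr/= -addrA lerD2l.
have -> : x ^+ n / (1 - x) = x ^+ n + x ^+ n.+1 / (1 - x).
  by rewrite exprS; field; rewrite subr_eq0 gt_eqF.
by rewrite lerD2r.
Qed.

End poissonization.

(** * The probability of filling the top values first *)

Definition top k m : seq nat := [seq (k - i)%N | i <- iota 0 m].

Section block_mass.
Variables (R : realType) (p : R).
Hypothesis p01 : 0 < p < 1.
Variables k m : nat.
Hypothesis mk : (m <= k)%N.
Local Notation q := (1 - p).
Local Notation J := (map (geometric_pmf p) (top k m)).

Let p0 : 0 < p. Proof. by case/andP: p01. Qed.
Let q0 : 0 < q. Proof. by case/andP: p01 => *; lra. Qed.
Let q1 : q < 1. Proof. by case/andP: p01 => *; lra. Qed.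
Let qk0 : 0 < q ^+ k. Proof. by rewrite exprn_gt0. Qed.

Let pmf_top i : (i < m)%N -> geometric_pmf p (k - i) = p * q ^+ (k - i.+1).
Proof. by move=> im; rewrite -(@subnSK i k)// (leq_trans im). Qed.

Lemma top_mass_ge0 : {in J, forall a, 0 <= a}.
Proof.
move=> a /mapP[j _ ->]; case: j => [|j] //=.
by rewrite mulr_ge0 ?ltW// exprn_gt0.
Qed.

Lemma top_mass_le : \sum_(a <- J) a <= 1 - q ^+ k.
Proof.
suff -> : \sum_(a <- J) a = q ^+ (k - m) - q ^+ k by rewrite lerB// exprn_ile1// ltW.
rewrite !big_map.
have: (m <= m)%N by []; elim: {1 3 4}m => [|n IH] nm.
  by rewrite big_nil subn0 subrr.
rewrite -addn1 iotaD big_cat/= IH ?(ltnW nm)// big_seq1 add0n pmf_top//.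
rewrite addn1 -(@subnSK n k) ?(leq_trans nm)// exprS; ring.
Qed.

Lemma top_arg_lt1 : 1 - q ^+ k < 1. Proof. by rewrite gtrBl. Qed.

(** The rates of the top values relative to the rate of everything above [k] do not
    depend on [k]: this self-similarity of the geometric law is why one function
    [profile] serves all [k]. *)
Lemma fill_prob_profile s :
  fill_prob J (1 - q ^+ k) s = profile p m (p * (q ^+ k * s)).
Proof.
rewrite /fill_prob /profile big_map big_map.
congr (expR _ * _); first by field; rewrite gt_eqF.
have -> : iota 0 m = index_iota 0 m by rewrite /index_iota subn0.
rewrite big_mkord; apply: eq_bigr => i _.
rewrite pmf_top// exprVn; congr (1 - expR (- _)).
have -> : q ^+ k = q ^+ (k - i.+1) * q ^+ i.+1.
  by rewrite -exprD subnK// (leq_trans _ mk).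
by field; rewrite expf_neq0// gt_eqF.
Qed.

(** The probability that the [m] largest values of [segment k] all appear before any
    value above [k]: [1 - p] to the [k] is the chance that a sample lies above [k],
    and the other factor sums over the position of the first such sample. *)
Definition block_mass : R :=
  q ^+ k * bdiff J (fun x => (1 - x)^-1) (1 - q ^+ k).

(** In units where values above [k] arrive at rate 1, cut the time axis at [S]. *)
Lemma block_mass_le (B S : R) : 0 <= S ->
  (forall c, 0 < c -> profile p m c <= B) ->
  block_mass <= S * B + expR (- S).
Proof.
move=> S0 HB.
have S0' : 0 <= S / q ^+ k by rewrite divr_ge0// ltW.
have HJ s : 0 < s -> fill_prob J (1 - q ^+ k) s <= B.
  by move=> s0; rewrite fill_prob_profile HB// !mulr_gt0.
rewrite /block_mass; apply: le_trans (ler_wpM2l (ltW qk0)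
  (total_le top_mass_ge0 top_arg_lt1 S0' HJ)) _.
have -> : (1 - (1 - q ^+ k)) = q ^+ k by ring.
have -> : q ^+ k * (S / q ^+ k) = S by field; rewrite gt_eqF.
by rewrite le_eqVlt; apply/orP; left; apply/eqP; field; rewrite gt_eqF.
Qed.

(** The time window of [profile_ge_window] has length [ln 2 / (1 - p)] in units where
    values above [k] arrive at rate 1, so the exponential rate [limit_constant] comes
    out with no loss beyond a constant factor. *)
Lemma block_mass_ge : p <= 2^-1 ->
  8^-1 * expR (- (limit_constant R / p)) <= block_mass.
Proof.
move=> p2.
have l2 := ln2_gt0 R.
have l1 : 2^-1 <= ln 2 :> R.
  have : ln (1 + - 2^-1) <= - 2^-1 :> R by apply: le_ln1Dx; lra.
  have -> : 1 + - 2^-1 = 2^-1 :> R by lra.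
  by rewrite lnV ?posrE// lerN2.
set s1 := ln 2 / (p * q ^+ k); set s2 := s1 / q.
have s10 : 0 < s1 by rewrite divr_gt0// mulr_gt0.
have s12 : s1 < s2 by rewrite ltr_pdivlMr// gtr_pMr.
set B := expR (- (ln 2 / (p * q))) * expR (- (cost_integral R / p)).
have HB s : s1 < s < s2 -> B <= fill_prob J (1 - q ^+ k) s.
  move=> /andP[/ltW s1s /ltW ss2]; rewrite fill_prob_profile.
  have pq0 : 0 < p * q ^+ k by rewrite mulr_gt0.
  apply: profile_ge_window => //.
    by move: s1s; rewrite /s1 ler_pdivrMr// mulrC mulrA.
  move: ss2; rewrite /s2 /s1 mulrAC ler_pdivlMr//.
  by rewrite mulrC mulrA.
rewrite /block_mass; apply: le_trans (ler_wpM2l (ltW qk0)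
  (total_ge top_mass_ge0 top_arg_lt1 (ltW s10) s12 HB)).
rewrite {HB}/B.
rewrite [leRHS]mulrA; have -> : q ^+ k * (s2 - s1) = ln 2 / q.
  by rewrite /s2 /s1; field; rewrite !gt_eqF.
have -> : ln 2 / (p * q) = ln 2 / p + ln 2 / q by field; rewrite !gt_eqF.
rewrite limit_constantE mulrDl !opprD !expRD.
set A := expR (- (ln 2 / p)); set C := expR (- (cost_integral R / p)).
have AB : 0 <= A * C by rewrite mulr_ge0 ?expR_ge0.
have E1 : 4^-1 <= expR (- (ln 2 / q)).
  have -> : 4^-1 = expR (- (2 * ln 2)) :> R.
    by rewrite -mulrN expRM_natl expRN_ln2 exprVn; congr (_^-1); rewrite expr2; lra.
  rewrite ler_expR lerN2 mulrC; apply: ler_wpM2r; first exact: ltW.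
  by rewrite -[leRHS]invrK lef_pV2 ?posrE//; move: p2; lra.
have E2 : 2^-1 <= ln 2 / q.
  by apply: le_trans l1 _; rewrite ler_pdivlMr// ler_piMr// ltW.
have E : 8^-1 <= ln 2 / q * expR (- (ln 2 / q)).
  have -> : 8^-1 = 2^-1 * 4^-1 :> R by rewrite -invfM; congr (_^-1); lra.
  by rewrite ler_pM.
have -> : ln 2 / q * (A * expR (- (ln 2 / q)) * C) = ln 2 / q * expR (- (ln 2 / q)) * (A * C) by ring.
by rewrite ler_wpM2r.
Qed.

End block_mass.

(** * Sampling: filled sets and independent trials *)

Section real_probability.
Context d (T : measurableType d) (R : realType) (P : probability T R).
Implicit Types A B : set T.

(** Real-valued, so that probabilities enter the estimates without casts. *)
Definition pr A : R := fine (P A).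

Lemma prE A : measurable A -> P A = (pr A)%:E.
Proof. by move=> mA; rewrite /pr fineK// fin_num_measure. Qed.

Lemma pr_ge0 A : 0 <= pr A.
Proof. exact: fine_ge0. Qed.

Lemma pr_setT : pr setT = 1.
Proof. by rewrite /pr probability_setT. Qed.

Lemma pr_le A B : measurable A -> measurable B -> A `<=` B -> pr A <= pr B.
Proof.
by move=> mA mB AB; rewrite -lee_fin -!prE// le_measure// inE.
Qed.

Lemma pr_setD A B : measurable A -> measurable B -> B `<=` A ->
  pr (A `\` B) = pr A - pr B.
Proof.
move=> mA mB BA; apply/EFin_inj; rewrite EFinB -!prE//; last exact: measurableD.
rewrite measureD ?(setIidr BA)//; by rewrite -ge0_fin_numE ?fin_num_measure.
Qed.

Lemma pr_setU A B : measurable A -> measurable B -> A `&` B = set0 ->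
  pr (A `|` B) = pr A + pr B.
Proof.
move=> mA mB AB0; apply/EFin_inj; rewrite EFinD -!prE//; last exact: measurableU.
exact: measureU.
Qed.

Lemma pr_le_setU A B : measurable A -> measurable B ->
  pr (A `|` B) <= pr A + pr B.
Proof.
move=> mA mB; rewrite -lee_fin EFinD -!prE//; last exact: measurableU.
exact: measureU2.
Qed.

Lemma pr_le_exists n (F : nat -> set T) : (forall i, measurable (F i)) ->
  pr [set w | exists2 i, (i < n)%N & F i w] <= \sum_(i < n) pr (F i).
Proof.
move=> mF.
have E m : [set w | exists2 i, (i < m.+1)%N & F i w] =
    [set w | exists2 i, (i < m)%N & F i w] `|` F m.
  apply/seteqP; split=> [w /= [i]|w /= [[i im Fi]|Fm]].
  - rewrite ltnS leq_eqVlt => /predU1P[-> Fm|im Fi]; first by right.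
    by left; exists i.
  - by exists i => //; apply: leqW.
  - by exists m.
have mE m : measurable [set w | exists2 i, (i < m)%N & F i w].
  elim: m => [|m IH]; last by rewrite E; apply: measurableU.
  by rewrite (_ : mkset _ = set0)//; apply/seteqP; split=> [w /= []|].
elim: n => [|n IH].
  rewrite big_ord0 (_ : mkset _ = set0) ?/pr ?measure0//.
  by apply/seteqP; split=> [w /= []|].
rewrite E big_ord_recr/=; apply: le_trans (pr_le_setU _ _) _ => //.
by rewrite lerD2r.
Qed.

End real_probability.

Section sampling.
Context d (T : measurableType d) (R : realType) (P : probability T R).
Variables (p : R) (X : nat -> {RV P >-> nat}).
Hypothesis hX : iid_geometric p X.
Local Notation q := (1 - p).
Local Notation pr := (pr P).
Implicit Types (B : set nat) (C : nat -> set nat) (D : set T).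

(** The common law of the samples, read off the first one. *)
Definition mass B : R := pr (X 0 @^-1` B).

Lemma measurable_sample i B : measurable (X i @^-1` B).
Proof. by rewrite -[X in measurable X]setTI; apply: measurable_funP. Qed.

Lemma pr_sample i B : P (X i @^-1` B) = (mass B)%:E.
Proof.
rewrite -prE; last exact: measurable_sample.
have disj j : P (X j @^-1` B) = (\sum_(n <oo | n \in B) (geometric_pmf p n)%:E)%E.
  have -> : X j @^-1` B = \bigcup_(n in B) (X j @^-1` [set n]).
    apply/seteqP; split=> [w Bw|w [n Bn /= E]]; first by exists (X j w).
    by rewrite /preimage/= E.
  rewrite measure_bigcup//=.
  - by apply: eq_eseriesr => n _; exact: (hX.2 j n).
  - by move=> n _; apply: measurable_sample.
  - by move=> n m _ _ [w [/= <- <-]].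
by rewrite !disj.
Qed.

Lemma mass_setT : mass setT = 1.
Proof. by rewrite /mass preimage_setT pr_setT. Qed.

Lemma mass_setD1 B j : B j -> mass (B `\ j) = mass B - geometric_pmf p j.
Proof.
move=> Bj; rewrite /mass [X in pr X](_ : _ = (X 0 @^-1` B) `\` (X 0 @^-1` [set j])) ?pr_setD//.
- by congr (_ - _); have := hX.2 0 j; rewrite /pr => /(congr1 fine).
- exact: measurable_sample.
- exact: measurable_sample.
- by move=> w /= ->.
Qed.

Lemma mass_setC B : mass (~` B) = 1 - mass B.
Proof.
rewrite -mass_setT -setTD /mass.
rewrite [X in pr X](_ : _ = (X 0 @^-1` setT) `\` (X 0 @^-1` B)) ?pr_setD//;
  exact: measurable_sample.
Qed.

Lemma mass_set0 : mass set0 = 0.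
Proof. by rewrite /mass preimage_set0 /pr measure0. Qed.

Lemma mass_segment k : mass (segment k) = 1 - q ^+ k.
Proof.
elim: k => [|k IH].
  rewrite (_ : segment 0 = set0) ?mass_set0 ?expr0 ?subrr//.
  by apply/seteqP; split=> [[|j]|].
have /mass_setD1 : segment k.+1 k.+1 by rewrite /segment/= leqnn.
have -> : segment k.+1 `\ k.+1 = segment k.
  apply/seteqP; split=> j; rewrite /segment/=.
    by move=> [/andP[-> j1] /eqP jk]; rewrite -ltnS ltn_neqAle jk.
  move=> /andP[-> jk]; split; first exact: leqW.
  by move=> E; move: jk; rewrite E ltnn.
by rewrite IH /= exprS; lra.
Qed.

Definition cyl m C l : set T := [set w | forall i, (i < l)%N -> C i (X (m + i)%N w)].

Lemma measurable_cyl m C l : measurable (cyl m C l).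
Proof.
have -> : cyl m C l = \bigcap_(i in `I_l) (X (m + i)%N @^-1` C i).
  by apply/seteqP; split=> w /= H i; exact: H.
by apply: fin_bigcap_measurable => // i _; exact: measurable_sample.
Qed.

(** [D] is independent of the samples from index [m] on. Testing cylinders suffices,
    so no generated sigma-algebra is needed. *)
Definition indep_after D m := measurable D /\ forall C l,
  pr (D `&` cyl m C l) = pr D * \prod_(i < l) mass (C i).

Lemma indep_after_setT m : indep_after setT m.
Proof.
split=> // C l; rewrite setTI pr_setT mul1r.
have := hX.1 (iota m l) (fun i => C (i - m)%N) (iota_uniq _ _) (fun=> Logic.I).
have -> : \bigcap_(i in [set` iota m l]) (X i @^-1` C (i - m)%N) = cyl m C l.
  apply/seteqP; split=> w /= H i.
    by move=> il; have := H (m + i)%N; rewrite /= mem_iota leq_addr ltn_add2l addKn;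
      apply.
  rewrite /= mem_iota => /andP[mi il]; have := H (i - m)%N.
  by rewrite subnKC// ltn_subLR//; apply.
rewrite /pr => ->; under eq_bigr do rewrite pr_sample.
rewrite -[m]addn0 iotaDl big_map.
have -> : iota 0 l = index_iota 0 l by rewrite /index_iota subn0.
rewrite big_mkord prodEFin/=; apply: eq_bigr => i _; by rewrite addn0 addKn.
Qed.

Definition fill m n B (J : seq nat) : set T :=
  [set w | (forall i, (i < n)%N -> B (X (m + i)%N w)) /\
           (forall j, j \in J -> exists2 i, (i < n)%N & X (m + i)%N w = j)].

Lemma fill_nil m n B : fill m n B [::] = cyl m (fun=> B) n.
Proof. by apply/seteqP; split=> w /=; [case|split]. Qed.

(** Missing the value [j] while staying in [B] is staying in [B] without [j]; this
    is one step of inclusion-exclusion. *)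
Lemma fill_cons m n B j J :
  fill m n B (j :: J) = fill m n B J `\` fill m n (B `\ j) J.
Proof.
apply/seteqP; split=> w /=.
  move=> [wB wJ]; split.
    by split=> // a aJ; apply: wJ; rewrite inE aJ orbT.
  move=> [+ _]; have [i il E] := wJ _ (mem_head j J).
  by move=> /(_ i il)[_ /=]; apply.
move=> [[wB wJ] nw]; split=> // a; rewrite inE => /predU1P[->|]; last exact: wJ.
apply: contrapT => nj; apply: nw; split=> // i il; split; first exact: wB.
by move=> /= E; apply: nj; exists i.
Qed.

Lemma fill_sub_nil m n B J : fill m n B J `<=` fill m n B [::].
Proof. by move=> w [wB _]; split. Qed.

Lemma measurable_fill m n B J : measurable (fill m n B J).
Proof.
elim: J B => [|j J IH] B; first by rewrite fill_nil; exact: measurable_cyl.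
by rewrite fill_cons; exact: measurableD.
Qed.

Lemma cyl_cat m n l B C : cyl m (fun=> B) n `&` cyl (m + n) C l =
  cyl m (fun i => if (i < n)%N then B else C (i - n)%N) (n + l).
Proof.
apply/seteqP; split=> w /=.
  move=> [wB wC] i il; case: ltnP => ni; first exact: wB.
  have /wC : (i - n < l)%N by rewrite ltn_subLR.
  by rewrite -addnA subnKC.
move=> wBC; split=> i il.
  by have := wBC i (ltn_addr _ il); rewrite il.
have := wBC (n + i)%N; rewrite ltn_add2l => /(_ il).
by rewrite ltnNge leq_addr/= addKn addnA.
Qed.

Definition fill_mass (x : R) J n :=
  bdiff (map (geometric_pmf p) J) (fun x => x ^+ n) x.

(** Induction on [J]: by [fill_cons] each new value to be hit subtracts the same
    probability with that value removed from [B], which is the recursion of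
    [bdiff]. The later cylinder and the earlier event [D] go along for free. *)
Lemma pr_fill_cyl D m n B J C l : indep_after D m -> uniq J -> {in J, forall j, B j} ->
  pr (D `&` fill m n B J `&` cyl (m + n) C l) =
  pr D * fill_mass (mass B) J n * \prod_(i < l) mass (C i).
Proof.
move=> [mD freeD]; elim: J B => [|j J IH] B /=.
  move=> _ _; rewrite fill_nil -setIA cyl_cat freeD /fill_mass /= -mulrA.
  congr (_ * _); rewrite big_split_ord/=; congr (_ * _).
    under eq_bigr do rewrite ltn_ord.
    by rewrite prodr_const card_ord.
  by apply: eq_bigr => i _; rewrite ltnNge leq_addr/= addKn.
move=> /andP[jJ uJ] BJ; have Bj : B j by apply: BJ; rewrite mem_head.
have BJ' : {in J, forall a, B a} by move=> a aJ; apply: BJ; rewrite inE aJ orbT.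
have mF E : measurable (D `&` fill m n E J `&` cyl (m + n) C l).
  by apply: measurableI; [apply: measurableI => //; exact: measurable_fill|exact: measurable_cyl].
rewrite fill_cons (_ : D `&` _ `&` _ = (D `&` fill m n B J `&` cyl (m + n) C l) `\`
   (D `&` fill m n (B `\ j) J `&` cyl (m + n) C l)); last first.
  by apply/seteqP; split=> w /=; tauto.
rewrite pr_setD//; last first.
  by move=> w /= [[Dw [wB wJ]] wC]; do 2!split => //; split=> // i il; have [] := wB _ il.
rewrite !IH//; last first.
  move=> a aJ; split; first exact: BJ'.
  by move=> /= E; move: jJ; rewrite -E aJ.
rewrite /fill_mass /= -mass_setD1//; ring.
Qed.

Lemma pr_fill n B J : uniq J -> {in J, forall j, B j} ->
  pr (fill 0 n B J) = fill_mass (mass B) J n.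
Proof.
move=> uJ BJ; have := @pr_fill_cyl setT 0 n B J (fun=> setT) 0 (indep_after_setT 0) uJ BJ.
rewrite big_ord0 mulr1 pr_setT mul1r setTI => <-; congr (pr _).
by apply/seteqP; split=> w /=; [split|case].
Qed.

Lemma fill_mass_ge0 n B J : uniq J -> {in J, forall j, B j} ->
  0 <= fill_mass (mass B) J n.
Proof. by move=> uJ BJ; rewrite -pr_fill ?pr_ge0. Qed.

Lemma fill_mass_le n B J : uniq J -> {in J, forall j, B j} ->
  fill_mass (mass B) J n <= mass B ^+ n.
Proof.
move=> uJ BJ; rewrite -[leRHS]/(fill_mass (mass B) [::] n) -!pr_fill//.
by apply: pr_le (@fill_sub_nil 0 n B J); exact: measurable_fill.
Qed.

(** The first sample outside [B] is part of the event, so that different [n] give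
    disjoint events whose probabilities add up. *)
Definition trial m N B J : set T := [set w | exists2 n, (n < N)%N &
  (fill m n B J `&` (X (m + n)%N @^-1` ~` B)) w].

Lemma measurable_trial m N B J : measurable (trial m N B J).
Proof.
rewrite (_ : trial m N B J = \bigcup_(n in `I_N) (fill m n B J `&` (X (m + n)%N @^-1` ~` B))).
  by apply: bigcup_measurable => n _; apply: measurableI;
    [exact: measurable_fill|exact: measurable_sample].
by apply/seteqP; split=> w /= [n ? ?]; exists n.
Qed.

Lemma trialS m N B J : trial m N.+1 B J =
  trial m N B J `|` (fill m N B J `&` (X (m + N)%N @^-1` ~` B)).
Proof.
apply/seteqP; split=> [w /= [n]|w /= [[n nN Fn]|FN]].
- rewrite ltnS leq_eqVlt => /predU1P[-> FN|nN Fn]; first by right.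
  by left; exists n.
- by exists n => //; apply: leqW.
- by exists N.
Qed.

(** The events indexed by the position [n] of the first sample outside [B] are
    disjoint, and each is a [fill] followed by a cylinder. *)
Lemma pr_trial_cyl D m H N B J C l : indep_after D m -> uniq J ->
    {in J, forall j, B j} -> (N <= H)%N ->
  pr (D `&` trial m N B J `&` cyl (m + H) C l) =
  pr D * (\sum_(n < N) (1 - mass B) * fill_mass (mass B) J n) *
  \prod_(i < l) mass (C i).
Proof.
move=> fD uJ BJ; elim: N => [|N IH] NH.
  rewrite big_ord0 mulr0 mul0r (_ : _ `&` _ = set0) ?/pr ?measure0//.
  by apply/seteqP; split=> [w /= [[_ []]]|].
have [mD _] := fD; have mc := measurable_cyl (m + H) C l.
have ms := measurable_sample (m + N) (~` B).
have mt := measurable_trial m N B J; have mf := measurable_fill m N B J.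
rewrite trialS setIUr setIUl pr_setU; first last.
- apply/seteqP; split=> // w /= [[[_ [n nN [_ /= nB]]] _] [[_ [[wB _] _]] _]].
  by apply: nB; exact: wB.
- by apply: measurableI => //; apply: measurableI => //; apply: measurableI.
- by apply: measurableI => //; apply: measurableI.
rewrite IH ?(ltnW NH)// big_ord_recr/= mulrDr mulrDl; congr (_ + _).
set E := _ `&` cyl _ _ _.
(* Position [n = N] is the escape, the rest of the window is unconstrained. *)
pose C' i := if i == 0%N then ~` B else if (i < H - N)%N then setT else C (i - (H - N))%N.
have -> : E = D `&` fill m N B J `&` cyl (m + N) C' (H - N + l).
  rewrite {}/E /C'; apply/seteqP; split=> w /=.
    move=> [[Dw [wF nB]] wC]; split=> // -[|i] il; first by rewrite addn0.
    case: ltnP => iH //=.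
    have /wC : (i.+1 - (H - N) < l)%N by rewrite ltn_subLR.
    by congr (C _ (X _ w)); move: NH iH; lia.
  move=> [[Dw wF] wC]; split; first split=> //; first split=> //.
    have := wC 0%N; rewrite addn0; apply; by lia.
  move=> i il; have := wC (H - N + i)%N.
  rewrite ltn_add2l => /(_ il).
  have -> : (H - N + i == 0)%N = false by lia.
  have -> : (H - N + i < H - N)%N = false by lia.
  by rewrite addKn; congr (C _ (X _ w)); lia.
rewrite pr_fill_cyl//.
suff -> : \prod_(i < H - N + l) mass (C' i) = (1 - mass B) * \prod_(i < l) mass (C i).
  by ring.
rewrite big_split_ord/=; congr (_ * _).
  have -> : (H - N = (H - N).-1.+1)%N by lia.
  rewrite big_ord_recl /C'/= mass_setC big1 ?mulr1// => i _.
  have -> : (bump 0 i < H - N)%N by have := ltn_ord i; rewrite /bump; lia.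
  by rewrite mass_setT.
apply: eq_bigr => i _; rewrite /C'.
have -> : (H - N + i == 0)%N = false by lia.
have -> : (H - N + i < H - N)%N = false by lia.
by rewrite addKn.
Qed.

(** Failure of a trial on samples [m] to [m + H - 1] keeps independence of what comes
    after, so that trials on consecutive windows multiply. *)
Lemma indep_after_setD_trial D m H B J : indep_after D m -> uniq J ->
  {in J, forall j, B j} ->
  let g := \sum_(n < H) (1 - mass B) * fill_mass (mass B) J n in
  pr (D `\` trial m H B J) = pr D * (1 - g) /\
  indep_after (D `\` trial m H B J) (m + H).
Proof.
move=> fD uJ BJ g; have [mD freeD] := fD.
have mt := measurable_trial m H B J.
have key C l : pr ((D `\` trial m H B J) `&` cyl (m + H) C l) =
    pr D * (1 - g) * \prod_(i < l) mass (C i).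
  have mc := measurable_cyl (m + H) C l.
  rewrite (_ : _ `&` _ = (D `&` cyl (m + H) C l) `\`
    (D `&` trial m H B J `&` cyl (m + H) C l)); last first.
    by apply/seteqP; split=> w /=; tauto.
  rewrite pr_setD; first last.
  - by move=> w /= [[]].
  - by apply: measurableI => //; apply: measurableI.
  - by apply: measurableI.
  rewrite (@pr_trial_cyl D m H H)//.
  have := @pr_fill_cyl D m H setT [::] C l fD isT.
  rewrite fill_nil /fill_mass/= mass_setT expr1n mulr1.
  rewrite (_ : D `&` _ `&` _ = D `&` cyl (m + H) C l) => [->//|].
    by rewrite -/g; ring.
  by apply/seteqP; split=> w /= [] => [[? ?]|] ? ; split.
have E : pr (D `\` trial m H B J) = pr D * (1 - g).
  have := key (fun=> setT) 0%N; rewrite big_ord0 mulr1 => <-; congr (pr _).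
  by apply/seteqP; split=> w /=; [split|case].
split=> //; split; first exact: measurableD.
by move=> C l; rewrite key E.
Qed.

End sampling.

(** * Trials on initial segments *)

Lemma mem_top k m j : (m <= k)%N -> (j \in top k m) = (k - m < j <= k)%N.
Proof.
move=> mk; apply/mapP/idP => [[i]|/andP[jl jr]].
  by rewrite mem_iota; lia.
by exists (k - j)%N; [rewrite mem_iota|]; lia.
Qed.

Lemma top_uniq k m : (m <= k)%N -> uniq (top k m).
Proof.
move=> mk; rewrite map_inj_in_uniq ?iota_uniq// => i j.
by rewrite !mem_iota; lia.
Qed.

Lemma top_segment k m : (m <= k)%N -> {in top k m, forall j, segment k j}.
Proof. by move=> mk j; rewrite mem_top// /segment/=; lia. Qed.

Section block_events.
Context d (T : measurableType d) (R : realType) (P : probability T R).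
Variables (p : R) (X : nat -> {RV P >-> nat}).
Hypotheses (p01 : 0 < p < 1) (hX : iid_geometric p X).
Local Notation q := (1 - p).
Local Notation pr := (pr P).

Definition trial_mass k m H : R :=
  \sum_(n < H) (1 - mass X (segment k)) * fill_mass p (mass X (segment k)) (top k m) n.

Let q0 : 0 < q. Proof. by case/andP: p01 => *; lra. Qed.
Let q1 : q < 1. Proof. by case/andP: p01 => *; lra. Qed.

Let trial_massE k m H : trial_mass k m H = q ^+ k *
  \sum_(n < H) bdiff (map (geometric_pmf p) (top k m)) (fun x => x ^+ n) (1 - q ^+ k).
Proof.
rewrite /trial_mass (mass_segment hX) mulr_sumr; apply: eq_bigr => n _.
by rewrite opprB addrC subrK.
Qed.

Lemma trial_mass_le k m H : (m <= k)%N -> trial_mass k m H <= block_mass p k m.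
Proof.
move=> mk; rewrite trial_massE /block_mass ler_wpM2l ?exprn_ge0 ?(ltW q0)//.
apply: partial_le_total; [exact: top_mass_ge0|exact: top_arg_lt1|exact: top_mass_le|].
move=> n; have := fill_mass_ge0 hX n (top_uniq mk) (top_segment mk).
by rewrite /fill_mass (mass_segment hX).
Qed.

Lemma block_mass_le_trial k m H : (m <= k)%N ->
  block_mass p k m <= trial_mass k m H + (1 - q ^+ k) ^+ H.
Proof.
move=> mk; have qk0 : 0 < q ^+ k by rewrite exprn_gt0.
have -> : (1 - q ^+ k) ^+ H = q ^+ k * ((1 - q ^+ k) ^+ H / (1 - (1 - q ^+ k))).
  by field; rewrite opprB addrC subrK gt_eqF.
rewrite trial_massE /block_mass -mulrDr ler_wpM2l ?(ltW qk0)//.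
apply: total_le_partial; [exact: top_mass_ge0|exact: top_arg_lt1|exact: top_mass_le|].
move=> n; have := fill_mass_le hX n (top_uniq mk) (top_segment mk).
by rewrite /fill_mass (mass_segment hX).
Qed.

Definition filled M k m : set T :=
  [set w | exists2 n, (n < M)%N & fill X 0 n (segment k) (top k m) w].

Lemma measurable_filled M k m : measurable (filled M k m).
Proof.
rewrite (_ : filled M k m = \bigcup_(n in `I_M) fill X 0 n (segment k) (top k m)).
  by apply: bigcup_measurable => n _; exact: measurable_fill.
by apply/seteqP; split=> w /= [n ? ?]; exists n.
Qed.

(** Once all the top values have been seen inside [segment k], either the first sample
    outside [segment k] completes a trial, or there is none up to time [H]. *)
Lemma filled_sub M H k m : (M <= H)%N -> filled M k m `<=`
  trial X 0 H (segment k) (top k m) `|` fill X 0 H (segment k) [::].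
Proof.
move=> MH w [n nM [wB wJ]].
have [[i0 iH wi0]|no] := pselect (exists2 i, (i < H)%N & ~ segment k (X i w)); last first.
  right; split=> // i iH; apply: contrapT => wi; apply: no; by exists i.
left; have ex : exists i, `[< (i < H)%N /\ ~ segment k (X i w) >].
  by exists i0; apply/asboolP.
case: (ex_minnP ex) => j /asboolP[jH wj] jmin.
have nj : (n <= j)%N by rewrite leqNgt; apply/negP => /wB.
exists j => //; split=> //; split=> [i ij|a /wJ[i ni <-]]; last first.
  by exists i => //; exact: leq_trans ni nj.
apply: contrapT => wi; suff : (j <= i)%N by rewrite leqNgt ij.
by apply: jmin; apply/asboolP; split=> //; exact: ltn_trans ij jH.
Qed.

(** A sample outside [segment k] eventually comes: let [H] tend to infinity in
    [filled_sub]. *)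
Lemma pr_filled_le M k m : (m <= k)%N -> pr (filled M k m) <= block_mass p k m.
Proof.
move=> mk.
have key H : (M <= H)%N -> pr (filled M k m) <= block_mass p k m + (1 - q ^+ k) ^+ H.
  move=> MH; have mt := measurable_trial X 0 H (segment k) (top k m).
  have mf J := measurable_fill X 0 H (segment k) J.
  apply: le_trans (pr_le P (measurable_filled M k m) (measurableU _ _ mt (mf [::]))
    (@filled_sub M H k m MH)) _.
  apply: le_trans (pr_le_setU P mt (mf [::])) _; apply: lerD.
    apply: le_trans (trial_mass_le H mk).
    have := pr_trial_cyl hX (fun=> setT) 0 (indep_after_setT hX 0) (top_uniq mk)
      (top_segment mk) (leqnn H).
    rewrite big_ord0 mulr1 pr_setT mul1r setTI -/(trial_mass k m H) => <-.
    rewrite (_ : _ `&` _ = trial X 0 H (segment k) (top k m))//.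
    by apply/seteqP; split=> w /=; [case|split].
  by rewrite (pr_fill hX)// /fill_mass/= (mass_segment hX).
have C : (block_mass p k m + (1 - q ^+ k) ^+ H) @[H --> \oo] --> block_mass p k m.
  rewrite -[X in _ --> X]addr0; apply: cvgD; first exact: cvg_cst.
  apply: cvg_expr; rewrite ger0_norm ?gtrBl ?exprn_gt0//.
  by rewrite subr_ge0 exprn_ile1// ltW.
rewrite -(cvg_lim _ C)//; apply: limr_ge; first exact: cvgP C.
by near=> H; apply: key; near: H; exact: nbhs_infty_ge.
Unshelve. all: by end_near. Qed.

Definition escape M k : set T :=
  [set w | exists2 i, (i < M)%N & (X i @^-1` ~` segment k) w].

Lemma measurable_escape M k : measurable (escape M k).
Proof.
rewrite (_ : escape M k = \bigcup_(i in `I_M) (X i @^-1` ~` segment k)).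
  by apply: bigcup_measurable => n _; exact: measurable_sample.
by apply/seteqP; split=> w /= [n ? ?]; exists n.
Qed.

Lemma pr_escape_le M k : pr (escape M k) <= M%:R * q ^+ k.
Proof.
apply: le_trans (pr_le_exists P M _) _ => [i|]; first exact: measurable_sample.
rewrite (eq_bigr (fun=> q ^+ k)).
  by rewrite sumr_const card_ord mulr_natl.
move=> i _; apply: EFin_inj; rewrite -prE; last exact: measurable_sample.
rewrite (pr_sample hX) mass_setC (mass_segment hX).
by rewrite opprB addrC subrK.
Qed.

End block_events.

(** * Discovery order and the first block *)

Section discovery.
Variable x : nat -> nat.
Implicit Types (n m k v : nat).

Definition ndistinct n := size (undup (mkseq x n)).

Lemma ndistinctS n :
  ndistinct n.+1 = ((x n \notin mkseq x n) + ndistinct n)%N.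
Proof.
rewrite /ndistinct mkseqS.
rewrite -(perm_size (perm_undup (s1 := x n :: mkseq x n) _)) /=.
  by case: ifP.
by move=> v; rewrite mem_rcons.
Qed.

Lemma ndistinct_mono m n : (m <= n)%N -> (ndistinct m <= ndistinct n)%N.
Proof.
elim: n => [|n IH]; first by rewrite leqn0 => /eqP->.
rewrite leq_eqVlt => /predU1P[->//|/IH]; rewrite ndistinctS; lia.
Qed.

Lemma ndistinct_new_inj m n : x m \notin mkseq x m -> x n \notin mkseq x n ->
  ndistinct m = ndistinct n -> m = n.
Proof.
wlog mn : m n / (m <= n)%N.
  by move=> H mx nx E; case/orP: (leq_total m n) => ?; [|symmetry]; apply: H.
move=> mx _ E; apply/eqP; rewrite eqn_leq mn leqNgt; apply/negP => /ndistinct_mono.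
by rewrite ndistinctS mx -E; lia.
Qed.

(** The number of distinct values grows by at most one per sample, so it takes every
    intermediate value. *)
Lemma exists_discovery k n : (0 < k <= ndistinct n)%N ->
  exists m, [/\ (m < n)%N, x m \notin mkseq x m & (ndistinct m).+1 = k].
Proof.
elim: n => [|n IH]; first by rewrite /ndistinct /=; lia.
rewrite ndistinctS => /andP[k0 kn].
have [kl|kl] := leqP k (ndistinct n).
  by have [|m [mn ? ?]] := IH; [rewrite k0|exists m; split=> //; exact: leqW].
exists n; split=> //; first by apply: contraT; rewrite negbK => xn; move: kn;
  rewrite xn; lia.
by move: kn; case: (x n \notin _) => /=; lia.
Qed.

Lemma discoveredE m : x m \notin mkseq x m ->
  discovered x (ndistinct m).+1 = x m.
Proof.
move=> mx; apply: xget_unique; first by exists m.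
by move=> v [m' [<- m'x /succn_inj E]]; rewrite (@ndistinct_new_inj m' m).
Qed.

Lemma first_occurrence n v : v \in mkseq x n ->
  exists m, [/\ (m < n)%N, x m = v & v \notin mkseq x m].
Proof.
elim: n => [|n IH]; first by [].
have [vn _|vn] := boolP (v \in mkseq x n).
  by have [m [mn ? ?]] := IH vn; exists m; split=> //; exact: leqW.
rewrite mkseqS mem_rcons inE (negbTE vn) orbF.
by move=> /eqP E; exists n; split.
Qed.

Lemma ndistinct_segment n k : [set` mkseq x n] = segment k -> ndistinct n = k.
Proof.
move=> E; rewrite -(size_iota 1 k); apply/perm_size/uniq_perm.
- exact: undup_uniq.
- exact: iota_uniq.
- move=> v; rewrite mem_undup mem_iota add1n ltnS.
  by have := congr1 (fun A : set nat => A v) E => /= /propeqP[] *; apply/idP/idP.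
Qed.

Lemma discovered_segment n k : [set` mkseq x n] = segment k ->
  discovered x @` segment k = segment k.
Proof.
move=> E; have nk := ndistinct_segment E.
apply/seteqP; split=> [v [i]|v].
  move=> /andP[i0 ik] <-.
  have [|m [mn mx <-]] := @exists_discovery i n; first by rewrite i0 nk.
  by rewrite discoveredE// -E /=; apply/mapP; exists m; rewrite ?mem_iota.
move=> Sv; have /first_occurrence[m [mn mv vm]] : v \in mkseq x n by move: Sv; rewrite -E.
rewrite -mv in vm; exists (ndistinct m).+1; last by rewrite discoveredE.
by rewrite /segment/= -nk; have := ndistinct_mono mn; rewrite ndistinctS vm; lia.
Qed.

(** If a segment is complete at time [n], any smaller block was complete at the time
    of its last discovery, hence by time [n]. *)
Lemma smaller_block n k K : [set` mkseq x n] = segment k ->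
  (1 <= K <= k)%N -> discovered x @` segment K = segment K ->
  exists2 m, (1 <= m <= n)%N & [set` mkseq x m] = segment K.
Proof.
move=> E /andP[K0 Kk] DK; have nk := ndistinct_segment E.
have [|m [mn mx mK]] := @exists_discovery K n; first by rewrite K0 nk.
exists m.+1 => //; rewrite -DK; apply/seteqP; split=> v /=.
  move=> /first_occurrence[a [am av va]]; rewrite -av in va.
  exists (ndistinct a).+1; last by rewrite discoveredE.
  by rewrite /segment/= -mK ltnS ndistinct_mono.
move=> [i /andP[i0 iK] <-].
have [|a [an ax ai]] := @exists_discovery i n; first by rewrite i0 nk (leq_trans iK).
rewrite -ai discoveredE//; apply/mapP; exists a => //.
rewrite mem_iota/= add0n ltnS leqNgt; apply/negP => /ndistinct_mono.
by rewrite ndistinctS mx; lia.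
Qed.

End discovery.

Lemma ereal_inf_nat (R : realType) (A : set nat) :
  (A = set0 /\ ereal_inf [set n%:R%:E | n in A] = +oo%E :> \bar R) \/
  (exists n, [/\ A n, forall m, A m -> (n <= m)%N &
     ereal_inf [set n%:R%:E | n in A] = n%:R%:E :> \bar R]).
Proof.
have [A0|/set0P[n0 An0]] := eqVneq A set0.
  by left; rewrite A0 image_set0 ereal_inf0.
right; have ex : exists n, `[< A n >] by exists n0; apply/asboolP.
case: (ex_minnP ex) => n /asboolP An nmin; exists n; split=> //.
  by move=> m Am; apply: nmin; apply/asboolP.
apply/eqP; rewrite eq_le; apply/andP; split.
  by apply: ereal_inf_lbound; exists n.
apply/ereal_infP => _ [m Am <-]; rewrite lee_fin ler_nat.
by apply: nmin; apply/asboolP.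
Qed.

(** Asks for some segment and not for the one of size [block_size]. *)
Definition block_time (x : nat -> nat) n :=
  exists2 k, (1 <= k)%N & [set` mkseq x n] = segment k.

Section first_block.
Variables (R : realType) (x : nat -> nat).

Let finite_esegment n : [set` mkseq x n] <> esegment (+oo%E : \bar R).
Proof.
move=> E; have : (esegment (+oo%E : \bar R)) (\max_(i <- mkseq x n) i).+1.
  by rewrite /esegment/= leey.
rewrite -E /= => H; by have := @leq_bigmax_seq _ _ xpredT id _ H isT; rewrite ltnn.
Qed.

(** The block size only serves to pick the least [block_time]: by [smaller_block],
    completing any segment entails having completed the first block. *)
Lemma block_samples_cases :
  (block_samples R x = +oo%E /\ forall n, ~ block_time x n) \/
  (exists n, [/\ block_time x n, forall m, block_time x m -> (n <= m)%N &
     block_samples R x = n%:R%:E]).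
Proof.
have esegE k : esegment (k%:R%:E : \bar R) = segment k.
  by apply/seteqP; split=> j; rewrite /esegment /segment/= lee_fin ler_nat;
    [case=> -> ->|move=> /andP].
set B := [set n : nat | (1 <= n)%N /\ [set` mkseq x n] = esegment (block_size R x)].
have timeB n : block_time x n -> exists2 m, (m <= n)%N & B m.
  move=> [k k1 Ek]; have Dk := discovered_segment Ek.
  have := @ereal_inf_nat R [set k : nat | (1 <= k)%N /\ discovered x @` segment k = segment k].
  rewrite -/(block_size R x) => -[[A0 _]|[K [[K1 DK] Kmin KE]]].
    by have : set0 k by rewrite -A0.
  have [|m /andP[m1 mn] Em] := smaller_block Ek _ DK.
    by rewrite K1 Kmin.
  by exists m => //; split=> //; rewrite KE esegE.
have Btime n : B n -> block_time x n.
  move=> [n1 En]; move: En.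
  have := @ereal_inf_nat R [set k : nat | (1 <= k)%N /\ discovered x @` segment k = segment k].
  rewrite -/(block_size R x) => -[[_ ->]|[K [[K1 DK] _ ->]]];
    first by move/finite_esegment.
  by rewrite esegE => En; exists K.
have := ereal_inf_nat R B; rewrite -/(block_samples R x) => -[[B0 ->]|[n [Bn nmin nE]]].
  left; split=> // n /timeB[m _ Bm]; by have : set0 m by rewrite -B0.
right; exists n; split=> //; first exact: Btime.
by move=> m /timeB[m' m'm /nmin nm']; exact: leq_trans nm' m'm.
Qed.

End first_block.

(** * Early and late blocks *)

Section block_time_events.
Context d (T : measurableType d) (R : realType) (P : probability T R).
Variables (X : nat -> {RV P >-> nat}).
Local Notation pr := (pr P).
Local Notation samples w := (fun i => X i w).

Lemma fill_segmentP n k w : fill X 0 n (segment k) (top k k) w <->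
  [set` mkseq (samples w) n] = segment k.
Proof.
have topE j : (j \in top k k) = (1 <= j <= k)%N by rewrite mem_top// subnn.
split=> [[wB wJ]|E].
  apply/seteqP; split=> j /=; first by move=> /mapP[i]; rewrite mem_iota => /wB ? ->.
  by rewrite /segment/= -topE => /wJ[i il <-]; apply/mapP; exists i; rewrite ?mem_iota.
split=> [i il|j]; first by rewrite -E /=; apply/mapP; exists i; rewrite ?mem_iota.
rewrite topE => jk; have : segment k j by [].
by rewrite -E /= => /mapP[i]; rewrite mem_iota => il ->; exists i.
Qed.

Lemma measurable_block_time n : measurable [set w | block_time (samples w) n].
Proof.
rewrite (_ : mkset _ = \bigcup_(k in [set k | (1 <= k)%N])
    fill X 0 n (segment k) (top k k)).
  by apply: bigcup_measurable => k _; exact: measurable_fill.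
by apply/seteqP; split=> w /= [k k1 E]; exists k => //; apply/fill_segmentP.
Qed.

(** [block_samples] takes countably many values, each finite one on an event decided
    by finitely many samples. *)
Lemma measurable_block_samples (f : set (\bar R)) :
  measurable [set w | f (block_samples R (samples w))].
Proof.
pose bt n := [set w | block_time (samples w) n].
have mbt n : measurable (bt n) := measurable_block_time n.
pose first n := bt n `\` \bigcup_(m in `I_n) bt m.
pose never := ~` \bigcup_n bt n.
have mfirst n : measurable (first n).
  by apply: measurableD => //; apply: bigcup_measurable.
have mnever : measurable never.
  by apply: measurableC; apply: bigcup_measurable.
have -> : [set w | f (block_samples R (samples w))] =
    (\bigcup_(n in [set n | f n%:R%:E]) first n) `|`
    (if pselect (f +oo%E) then never else set0).
  apply/seteqP; split=> w /=.
    case: (block_samples_cases R (samples w)) => [[-> nobt]|[n [bn nmin ->]]] fw.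
      by right; case: pselect => // ?; move=> [n _ /nobt].
    left; exists n => //; split=> // -[m /= mn /nmin]; by rewrite leqNgt mn.
  case: (block_samples_cases R (samples w)) => [[-> nobt]|[n [bn nmin ->]]].
    by move=> [[n _ [bn _]]|]; [case: (nobt n bn)|case: pselect].
  move=> [[m fm [bm nfirst]]|]; last first.
    by case: pselect => // ? /=; case; exists n.
  suff <- : m = n by [].
  apply/eqP; rewrite eqn_leq nmin// andbT leqNgt; apply/negP => nm.
  by apply: nfirst; exists n.
apply: measurableU; last by case: pselect => ? /=; [exact: mnever|exact: measurable0].
by apply: bigcup_measurable => n _.
Qed.

End block_time_events.

Lemma sum_indicator_le (R : realDomainType) (c : R) a n : 0 <= c ->
  \sum_(k < n) (if (k < a)%N then c else 0) <= a%:R * c.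
Proof.
move=> c0; suff -> : \sum_(k < n) (if (k < a)%N then c else 0) = (minn n a)%:R * c.
  by rewrite ler_wpM2r// ler_nat geq_minr.
elim: n => [|n IH]; first by rewrite big_ord0 min0n mul0r.
rewrite big_ord_recr/= IH; case: ltnP => na.
  by rewrite (minn_idPl na) -natr1; ring.
by rewrite (minn_idPr (leqW na)) addr0.
Qed.

(** The value [k] comes before all larger ones with probability [p], by
    self-similarity. *)
Lemma block_mass1 (R : realType) (p : R) k : 0 < p < 1 -> (0 < k)%N ->
  block_mass p k 1 = p.
Proof.
case: k => // k /andP[p0 p1] _; rewrite /block_mass /=.
have z0 : (1 - p) ^+ k != 0 by rewrite expf_neq0// gt_eqF//; lra.
have q0 : 1 - p != 0 by rewrite gt_eqF//; lra.
have -> : 1 - (1 - (1 - p) ^+ k.+1) = (1 - p) * (1 - p) ^+ k by rewrite exprS; ring.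
have -> : 1 - (1 - (1 - p) ^+ k.+1 - p * (1 - p) ^+ k) = (1 - p) ^+ k.
  by rewrite exprS; ring.
by rewrite exprS; field; rewrite z0 q0.
Qed.

Section tails.
Context d (T : measurableType d) (R : realType) (P : probability T R).
Variables (p : R) (X : nat -> {RV P >-> nat}).
Hypothesis hX : iid_geometric p X.
Local Notation q := (1 - p).
Local Notation pr := (pr P).
Local Notation samples w := (fun i => X i w).

Definition early M : set T :=
  [set w | (block_samples R (samples w) <= M%:R%:E)%E].

Definition late M : set T :=
  [set w | (M%:R%:E < block_samples R (samples w))%E].

(** A union bound over the size [k] of the segment completed by time [M]. It is
    affordable because it runs over values and not over times: the event that
    [segment k] is ever filled before a larger value is counted once per [k]. Sizes
    beyond [K] need a sample above [K]. For the others only the top [rank k] values are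
    asked for, so that few distinct bounds are needed: [k < 4] gives [p], then 4
    values give [U4], and finally [m] values give [Um]. *)
Lemma pr_early_le M K m (U4 Um : R) : 0 < p < 1 ->
    (forall k, (4 <= k)%N -> block_mass p k 4 <= U4) ->
    (forall k, (m <= k)%N -> block_mass p k m <= Um) -> 0 <= U4 -> 0 <= Um ->
  pr (early M) <= M%:R * q ^+ K + 4%:R * p + m%:R * U4 + K.+1%:R * Um.
Proof.
move=> p01 HU4 HUm U40 Um0; have /andP[p0 _] := p01.
pose rank k := if (k < 4)%N then 1%N else if (k < m)%N then 4%N else m.
pose F k := if k is 0%N then set0 else filled X M.+1 k (rank k).
have mF k : measurable (F k) by case: k => //= k; exact: measurable_filled.
have rank_le k : (0 < k)%N -> (rank k <= k)%N.
  by move=> k0; rewrite /rank; case: ifP => //; do ?case: ifP; lia.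
have mS : measurable [set w | exists2 k, (k < K.+1)%N & F k w].
  rewrite (_ : mkset _ = \bigcup_(k in `I_K.+1) F k).
    by apply: bigcup_measurable => k _; exact: mF.
  by apply/seteqP; split=> w /= [k ? ?]; exists k.
have sub : early M `<=` escape X M K `|` [set w | exists2 k, (k < K.+1)%N & F k w].
  move=> w; rewrite /early/=.
  case: (block_samples_cases R (samples w)) => [[-> _]//|[n [[k k1 E] _ ->]]].
  rewrite lee_fin ler_nat => nM.
  have [wB wJ] := (fill_segmentP X n k w).2 E.
  have [kK|Kk] := leqP k K; [right|left].
    exists k => //; case: k k1 E wB wJ kK => // k _ E wB wJ kK.
    exists n => //; split=> // j; rewrite mem_top ?rank_le// => /andP[jl jk].
    by apply: wJ; rewrite mem_top// subnn jk (leq_ltn_trans _ jl).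
  have [|i il ik] := wJ k; first by rewrite mem_top// subnn k1 leqnn.
  exists i; first exact: leq_trans il nM.
  by rewrite /= ik /segment/= => /andP[_]; rewrite leqNgt Kk.
have mE : measurable (early M).
  exact: (measurable_block_samples X [set y | (y <= M%:R%:E)%E]).
have me := measurable_escape X M K.
apply: le_trans (pr_le P mE (measurableU _ _ me mS) sub) _.
apply: le_trans (pr_le_setU P me mS) _; rewrite -!addrA; apply: lerD.
  exact: pr_escape_le.
apply: le_trans (pr_le_exists P K.+1 mF) _.
have FU k : pr (F k) <= (if (k < 4)%N then p else 0) +
    ((if (k < m)%N then U4 else 0) + Um).
  have le0 : 0 <= (if (k < m)%N then U4 else 0) by case: ifP.
  have le0' : 0 <= (if (k < 4)%N then p else 0) by case: ifP => // _; exact: ltW.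
  case: k => [|k] in le0 le0' *.
    by rewrite /F /pr measure0/= !addr_ge0.
  rewrite /F; have := pr_filled_le p01 hX M.+1 (rank_le k.+1 isT).
  move/le_trans; apply; rewrite /rank; case: ifP => [k4|/negbT k4].
    by rewrite block_mass1// lerDl addr_ge0.
  rewrite add0r -leqNgt in k4 *; case: ifP => km.
    by apply: le_trans (HU4 _ k4) _; rewrite lerDl.
  by rewrite add0r; apply: HUm; rewrite leqNgt km.
apply: (@le_trans _ _ (\sum_(k < K.+1) ((if (k < 4)%N then p else 0) +
    ((if (k < m)%N then U4 else 0) + Um)))); first by apply: ler_sum => k _.
rewrite big_split/= big_split/=.
apply: lerD; first exact/sum_indicator_le/ltW.
apply: lerD; first exact: sum_indicator_le.
by rewrite sumr_const card_ord mulr_natl.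
Qed.

Variables (level width : nat -> nat).
Hypothesis level_gt0 : forall i, (0 < level i)%N.

Fixpoint start i := if i is j.+1 then (start j + width j)%N else 0%N.

Definition window_trial i := trial X (start i) (width i) (segment (level i))
  (top (level i) (level i)).

Fixpoint all_fail i : set T :=
  if i is j.+1 then all_fail j `\` window_trial j else setT.

Lemma pr_all_fail L : indep_after X (all_fail L) (start L) /\
  pr (all_fail L) =
  \prod_(i < L) (1 - trial_mass p X (level i) (level i) (width i)).
Proof.
elim: L => [|L [fL pL]].
  by rewrite big_ord0 /= pr_setT; split=> //; exact: indep_after_setT hX 0.
have [prE fE] := indep_after_setD_trial hX (width L) fL (top_uniq (leqnn (level L)))
  (top_segment (leqnn (level L))).
by split=> //; rewrite big_ord_recr/= -pL.
Qed.

Lemma start_mono i j : (i <= j)%N -> (start i <= start j)%N.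
Proof. by move=> /subnK <-; elim: (j - i)%N => // n IH; rewrite addSn /=; lia. Qed.

(** A successful trial in window [i] completes a block, unless an earlier sample has
    already exceeded [level i]. Success probabilities multiply by independence; the
    exceptions are bounded by a union bound. *)
Lemma pr_late_le L : pr (late (start L)) <=
  \prod_(i < L) (1 - trial_mass p X (level i) (level i) (width i)) +
  \sum_(i < L) (start i)%:R * q ^+ level i.
Proof.
have [[mL _] <-] := pr_all_fail L.
pose F i := escape X (start i) (level i).
have mF i : measurable (F i) := measurable_escape X (start i) (level i).
have mS : measurable [set w | exists2 i, (i < L)%N & F i w].
  rewrite (_ : mkset _ = \bigcup_(k in `I_L) F k).
    by apply: bigcup_measurable => k _; exact: mF.
  by apply/seteqP; split=> w /= [k ? ?]; exists k.
have mE : measurable (late (start L)).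
  exact: (measurable_block_samples X [set y | ((start L)%:R%:E < y)%E]).
have sub : late (start L) `<=` all_fail L `|` [set w | exists2 i, (i < L)%N & F i w].
  move=> w lw.
  have [|noesc] := pselect (exists2 i, (i < L)%N & F i w); first by right.
  left; have nobt n : (n <= start L)%N -> ~ block_time (samples w) n.
    move=> nL bn; move: lw; rewrite /late/=.
    case: (block_samples_cases R (samples w)) => [[_ /(_ n)]//|[m [_ mmin ->]]].
    by rewrite lte_fin ltr_nat ltnNge (leq_trans (mmin _ bn)).
  have: (L <= L)%N by []; elim: {1 3}L => // i IH iL; split; first exact/IH/ltnW.
  move=> [n nw [[wB wJ] _]].
  apply: (nobt (start i + n)%N).
    by apply: leq_trans (start_mono iL); rewrite /= leq_add2l ltnW.
  exists (level i) => //; apply/fill_segmentP; split.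
    move=> a an; have [ai|ia] := ltnP a (start i); last first.
      have /wB : (a - start i < n)%N by rewrite ltn_subLR.
      by rewrite subnKC.
    by apply: contrapT => na; apply: noesc; exists i => //; exists a.
  move=> j /wJ[a an <-]; exists (start i + a)%N => //; by rewrite ltn_add2l.
apply: le_trans (pr_le P mE (measurableU _ _ mL mS) sub) _.
apply: le_trans (pr_le_setU P mL mS) _; rewrite lerD2l.
apply: le_trans (pr_le_exists P L mF) _; apply: ler_sum => i _.
exact: pr_escape_le.
Qed.

End tails.

(** * Exponential estimates as p tends to 0 *)

Lemma ex_nat_ceil (R : realType) (x : R) : 0 <= x ->
  exists2 n : nat, x <= n%:R & n%:R <= x + 1.
Proof.
move=> x0; exists (Num.truncn x).+1; first by apply/ltW/truncnS_gt.
by rewrite -natr1 lerD2r truncn_le.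
Qed.

(** Exponentially small quantities in [1 / p] beat every power of [p]. *)
Lemma expR_decay (R : realType) (a p : R) n : 0 < a -> 0 < p ->
  expR (- (a / p)) <= n.+1`!%:R / a ^+ n.+1 * p ^+ n.+1.
Proof.
move=> a0 p0; have ap0 : 0 < a / p by rewrite divr_gt0.
have := expR_ge1Dxn n (ltW ap0); rewrite expr_div_n.
have f0 : 0 < n.+1`!%:R :> R by rewrite ltr0n fact_gt0.
have A0 : 0 < a ^+ n.+1 by rewrite exprn_gt0.
have Q0 : 0 < p ^+ n.+1 by rewrite exprn_gt0.
move: (n.+1`!%:R) (a ^+ n.+1) (p ^+ n.+1) f0 A0 Q0 => F A Q F0 A0 Q0 le_exp.
have x0 : 0 < A / Q / F by rewrite !divr_gt0.
have -> : F / A * Q = (A / Q / F)^-1 by field; rewrite !gt_eqF.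
by rewrite expRN lef_pV2 ?posrE ?expR_gt0//; move: le_exp; lra.
Qed.

Lemma expRN1V_le (R : realType) (p : R) : 0 < p -> expR (- p^-1) <= p.
Proof.
by move=> p0; have := expR_decay 0 ltr01 p0; rewrite div1r !expr1 divr1 mul1r.
Qed.

Section asymptotics.
Variable R : realType.
Local Notation b := (limit_constant R).
Implicit Types p e : R.

Lemma limit_constant_gt0 : 0 < b.
Proof.
by rewrite limit_constantE; have := ln2_gt0 R; have := cost_integral_ge0 R; lra.
Qed.

Lemma expr1B_le p n : 0 < p < 1 -> (1 - p) ^+ n <= expR (- (p * n%:R)).
Proof.
move=> /andP[p0 p1]; rewrite -mulNr mulrC expRM_natl.
apply: lerXn2r; rewrite ?nnegrE ?expR_ge0//; first by lra.
exact: expR_ge1Dx.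
Qed.

(** For [c] of order [p] each factor of the profile is of order [c], so four factors
    make the mass small against [p ^+ 2], which is what summing over about
    [2 / p ^+ 2] sizes requires. *)
Lemma block_mass4_le p k : 0 < p <= 2^-1 -> (4 <= k)%N ->
  block_mass p k 4 <= (24 * 16 ^+ 4 + 6) * p ^+ 3.
Proof.
move=> /andP[p0 p2] k4; have p01 : 0 < p < 1 by apply/andP; split; lra.
have q0 : 0 < 1 - p by lra.
have pV0 : 0 <= p^-1 by rewrite invr_ge0 ltW.
have HB c : 0 < c -> profile p 4 c <= 24 * 16 ^+ 4 * p ^+ 4.
  move=> c0; rewrite /profile.
  have factor i : (i < 4)%N -> 0 <= 1 - expR (- (c * (1 - p)^-1 ^+ i.+1)) <= 16 * c.
    move=> i4; set z := c * _.
    have z0 : 0 < z by rewrite mulr_gt0// exprn_gt0// invr_gt0.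
    have /andP[/ltW-> _] /= := expRN_bounds z0.
    apply: (@le_trans _ _ z); first by have := expR_ge1Dx (- z); lra.
    rewrite /z mulrC ler_wpM2r ?(ltW c0)//.
    have V2 : (1 - p)^-1 <= 2 by rewrite -[leRHS]invrK lef_pV2 ?posrE//; lra.
    have V1 : 1 <= (1 - p)^-1 by rewrite invf_ge1//; lra.
    apply: (@le_trans _ _ ((1 - p)^-1 ^+ 4)); first exact: ler_weXn2l.
    have -> : 16 = 2 ^+ 4 :> R by ring.
    by rewrite ler_pXn2r// nnegrE; lra.
  apply: (@le_trans _ _ (24 / c ^+ 4 * p ^+ 4 * (16 * c) ^+ 4)).
    apply: ler_pM; rewrite ?expR_ge0//.
    - by apply: prodr_ge0 => i _; have /andP[] := factor i (ltn_ord i).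
    - exact: (expR_decay 3).
    - have -> : (16 * c) ^+ 4 = \prod_(i < 4) (16 * c) by rewrite prodr_const card_ord.
      by apply: ler_prod => i _; apply: factor.
  by rewrite le_eqVlt; apply/orP; left; apply/eqP; field; rewrite gt_eqF.
have := block_mass_le p01 k4 pV0 HB; move/le_trans; apply.
have E : expR (- p^-1) <= 6 * p ^+ 3.
  by have := expR_decay 2 ltr01 p0; rewrite div1r expr1n divr1.
rewrite [leRHS]mulrDl lerD// le_eqVlt; apply/orP; left; apply/eqP.
by field; rewrite gt_eqF.
Qed.

(** Taking [m] at least [p ^- 2] makes the Riemann sum run up to [1 / p], and makes
    the correction of [profile_le_cap] bounded since [(1 - p) ^+ m] is at most [p].
    The time axis is cut at [(b + 1) / p], where the exponential is already
    negligible against the main term. *)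
Lemma block_mass_upper e : 0 < e -> exists c p1 : R, [/\ 0 <= c, 0 < p1 &
  forall p, 0 < p < 1 -> p < p1 -> forall m : nat, p^-1 <= m%:R * p ->
  forall k, (m + m <= k)%N ->
  block_mass p k (m + m) <= c / p * expR (- ((b - e) / p)) + expR (- ((b + 1) / p))].
Proof.
move=> e0; have [Y HY] := optimal_product_le e0.
have b0 := limit_constant_gt0.
exists ((b + 1) * (8 * expR (cost_integral R))), (Num.max Y 1)^-1; split.
- by rewrite mulr_ge0 ?mulr_ge0 ?expR_ge0//; lra.
- by rewrite invr_gt0 lt_max ltr01 orbT.
move=> p p01 pY m mp k mk; have [p0 p1] := andP p01.
have q0 : 0 < 1 - p by lra.
(* By the choice of [p1], [m * p] passes the Riemann threshold [Y]. *)
have YV : Y <= p^-1.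
  apply: le_trans (_ : Num.max Y 1 <= _); first by rewrite le_max lexx.
  by rewrite -[leLHS]invrK lef_pV2 ?posrE ?invr_gt0 ?lt_max ?ltr01 ?orbT// ltW.
have l0 := ln2_gt0 R.
have qm : (1 - p) ^+ m <= p.
  apply: le_trans (expr1B_le m p01) _; apply: le_trans (expRN1V_le p0).
  by rewrite ler_expR lerN2 mulrC.
have S0 : 0 <= (b + 1) / p by rewrite divr_ge0 ?(ltW p0)//; lra.
have HB c : 0 < c -> profile p (m + m) c <=
    8 * expR (cost_integral R) * expR (- ((b - e) / p)).
  move=> c0; apply: le_trans (profile_le_cap p01 m c0) _.
  have P := HY p p01 m (le_trans YV mp).
  have E1 : expR ((1 - p) ^+ m * ln 2 / p) <= 2.
    rewrite -[leRHS](@lnK R 2) ?posrE// ler_expR ler_pdivrMr// mulrC.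
    by rewrite ler_wpM2l// ltW.
  have E2 : expR (- ((1 - p) * ln 2 / p)) = 2 * expR (- (ln 2 / p)).
    have -> : - ((1 - p) * ln 2 / p) = ln 2 - ln 2 / p by field; rewrite gt_eqF.
    by rewrite expRD lnK ?posrE.
  have E3 : expR (- ((b - e) / p)) = expR (- (ln 2 / p)) * expR (- ((cost_integral R - e) / p)).
    by rewrite -expRD limit_constantE; congr expR; field; rewrite gt_eqF.
  rewrite /profile_cap E2 E3.
  apply: (@le_trans _ _ (2 * (2 * expR (- (ln 2 / p)) *
    (2 * expR (cost_integral R) * expR (- ((cost_integral R - e) / p)))))).
    apply: ler_pM => //; rewrite ?expR_ge0 ?mulr_ge0 ?expR_ge0//.
      apply: prodr_ge0 => i _.
      have : 0 < ln 2 * (1 - p)^-1 ^+ i.+1 by rewrite mulr_gt0// exprn_gt0// invr_gt0.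
      by move/expRN_bounds => /andP[/ltW].
    by rewrite ler_wpM2l// mulr_ge0// expR_ge0.
  by rewrite le_eqVlt; apply/orP; left; apply/eqP; ring.
apply: le_trans (block_mass_le p01 mk S0 HB) _; rewrite lerD2r.
by rewrite le_eqVlt; apply/orP; left; apply/eqP; ring.
Qed.

End asymptotics.

(** * The two tails *)

Section tail_bounds.
Variable R : realType.
Local Notation b := (limit_constant R).
Implicit Types p e : R.

(** The first [M] samples are unlikely to exceed [K], which is of order
    [expR ((b - e) / p)] up to powers of [p]. Except for the first [m + m] of them, sizes
    have a mass at most [expR (- ((b - e / 2) / p))], again up to powers of [p], so the
    union bound leaves [expR (- (e / 2 / p))]. *)
Lemma early_tail e : 0 < e -> e <= b -> exists c p1 : R, 0 < p1 /\
  forall p, 0 < p < 1 -> p < p1 ->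
  forall d (T : measurableType d) (P : probability T R) (X : nat -> {RV P >-> nat}),
  iid_geometric p X ->
  forall M : nat, M%:R <= expR (expR ((b - e) / p)) -> pr P (early X M) <= c * p.
Proof.
move=> e0 eb; have e20 : 0 < e / 2 by lra.
have [C [p1 [C0 p10 HC]]] := block_mass_upper e20.
have b0 := limit_constant_gt0 R.
pose A : R := 24 * 16 ^+ 4 + 6.
have A0 : 0 <= A by rewrite /A; have : 0 <= (16 : R) ^+ 4 by []; lra.
exists (1 + 4 + 4 * A + 4 * (C + 1) * (24 / (e / 2) ^+ 4)), (Num.min p1 2^-1).
split=> [|p p01]; first by rewrite lt_min p10/=; lra.
rewrite lt_min => /andP[pp1 p2] d T P X hX M HM; have [p0 p1'] := andP p01.
have q0 : 0 < 1 - p by lra.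
have pV0 : 0 < p^-1 by rewrite invr_gt0.
have pV1 : 1 <= p^-1 by rewrite invf_ge1// ltW.
have pV2 : 1 <= p^-1 ^+ 2 by rewrite exprn_ege1.
(* The number of values asked for is [m + m]: half to climb to [ln 2], half for the
   Riemann sum. *)
have [m m_ge m_le] := @ex_nat_ceil R (p^-1 ^+ 2) (exprn_ge0 2 (ltW pV0)).
have mp : p^-1 <= m%:R * p by rewrite -ler_pdivrMr// -expr2.
set x := expR ((b - e) / p).
have x1 : 1 <= x by rewrite -expR0 ler_expR divr_ge0 ?(ltW p0)//; lra.
(* The summand [p^-1] in [x + p^-1] leaves [expR (- p^-1)] once [(1 - p) ^+ K] has
   absorbed [M], which is at most [expR x]. *)
have [|K K_ge K_le] := @ex_nat_ceil R ((x + p^-1) / p).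
  by rewrite divr_ge0 ?(ltW p0)//; lra.
have U40 : 0 <= A * p ^+ 3 by rewrite mulr_ge0// exprn_ge0// ltW.
set Um := C / p * expR (- ((b - e / 2) / p)) + expR (- ((b + 1) / p)).
have Um0 : 0 <= Um.
  by rewrite addr_ge0 ?expR_ge0// mulr_ge0 ?expR_ge0// divr_ge0 ?(ltW p0).
have HU4 k : (4 <= k)%N -> block_mass p k 4 <= A * p ^+ 3.
  by apply: block_mass4_le; apply/andP; split=> //; exact: ltW.
have HUm k : (m + m <= k)%N -> block_mass p k (m + m) <= Um by exact: HC.
apply: le_trans (pr_early_le hX M K p01 HU4 HUm U40 Um0) _.
set Z := 4 * (C + 1) * _.
have -> : (1 + 4 + 4 * A + Z) * p = p + 4%:R * p + 4 * A * p + Z * p by ring.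
apply: lerD; last first; [|apply: lerD; last first; [|apply: lerD => //]].
- have K_le' : K.+1%:R <= 4 * p^-1 ^+ 2 * x.
    rewrite -natr1; apply: (@le_trans _ _ ((x + p^-1) / p + 2)); first by lra.
    rewrite mulrDl -expr2 expr2 in pV2 *.
    have h1 : x / p <= p^-1 * p^-1 * x by rewrite mulrC ler_wpM2r//;
      [lra|rewrite -[leLHS]mul1r ler_wpM2r// ltW].
    have h2 : p^-1 * p^-1 <= p^-1 * p^-1 * x by rewrite ler_peMr// mulr_ge0// ltW.
    by lra.
  apply: (@le_trans _ _ (4 * p^-1 ^+ 2 * x * Um)); first exact: ler_wpM2r.
  have E1 : x * expR (- ((b - e / 2) / p)) = expR (- (e / 2 / p)).
    by rewrite -expRD; congr expR; field; rewrite gt_eqF.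
  have E2 : x * expR (- ((b + 1) / p)) <= expR (- (e / 2 / p)).
    rewrite -expRD ler_expR -mulNr -mulrDl -mulNr ler_wpM2r ?(ltW pV0)//; lra.
  have xUm : x * Um <= (C + 1) / p * expR (- (e / 2 / p)).
    rewrite /Um mulrDr mulrCA E1 [(C + 1) / p]mulrDl [leRHS]mulrDl; apply: lerD => //.
    by apply: le_trans E2 _; rewrite ler_peMl ?expR_ge0// div1r.
  rewrite -mulrA;
    apply: (@le_trans _ _ (4 * p^-1 ^+ 2 * ((C + 1) / p * (24 / (e / 2) ^+ 4 * p ^+ 4)))).
    apply: ler_wpM2l; first by rewrite mulr_ge0// exprn_ge0// ltW.
    apply: le_trans xUm _; apply: ler_wpM2l; last exact: (expR_decay 3).
    by rewrite divr_ge0 ?(ltW p0)//; lra.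
  by rewrite le_eqVlt; apply/orP; left; apply/eqP; rewrite /Z; field; rewrite !gt_eqF.
- apply: (@le_trans _ _ (4 * p^-1 ^+ 2 * (A * p ^+ 3))).
    by rewrite ler_wpM2r// natrD; lra.
  by rewrite le_eqVlt; apply/orP; left; apply/eqP; field; rewrite gt_eqF.
- apply: le_trans (expRN1V_le p0).
  apply: (@le_trans _ _ (expR x * expR (- (p * K%:R)))).
    by apply: ler_pM => //; [rewrite exprn_ge0// ltW|exact: expr1B_le].
  rewrite -expRD ler_expR.
  by move: K_ge; rewrite ler_pdivrMr// mulrC; lra.
Qed.

(** About [expR (b / p) / p] windows are used, each successful with probability at
    least [expR (- (b / p)) / 16]. Levels are spaced by [D], of order [p ^- 2], so that
    the samples before window [i] are too few, by a factor
    [expR (- ((2 * b + 1) / p))], to exceed [level i]. The windows end at time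
    exponential in (number of windows) times [D * p], whose double logarithm is
    [b / p] up to terms of order [ln (1 / p)]. *)
Lemma late_tail e : 0 < e -> exists c p1 : R, 0 < p1 /\
  forall p, 0 < p < 1 -> p < p1 ->
  forall d (T : measurableType d) (P : probability T R) (X : nat -> {RV P >-> nat}),
  iid_geometric p X ->
  exists2 M : nat, M%:R < expR (expR ((b + e) / p)) & pr P (late X M) <= c * p.
Proof.
move=> e0; have b0 := limit_constant_gt0 R.
(* [B] collects the constants in the bound on [ln] of the last window end. *)
pose B := 2 * (5 * b + 6).
exists (16 + 4 * (b + 2) * 24), (Num.min 16^-1 (e ^+ 3 / (6 * B))).
have B0 : 0 < B by rewrite /B; lra.
have eB : 0 < e ^+ 3 / (6 * B) by rewrite divr_gt0 ?exprn_gt0// mulr_gt0.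
split=> [|p p01]; first by rewrite lt_min eB andbT invr_gt0.
rewrite lt_min => /andP[p16 pe] d T P X hX; have [p0 p1] := andP p01.
have q0 : 0 < 1 - p by lra.
have pV0 : 0 < p^-1 by rewrite invr_gt0.
have pV1 : 1 <= p^-1 by rewrite invf_ge1// ltW.
set y := expR (b / p).
have y1 : 1 <= y by rewrite -expR0 ler_expR divr_ge0 ?(ltW p0)// ltW.
have y0 : 0 < y by lra.
have [|L L_ge L_le] := @ex_nat_ceil R (y / p); first by rewrite divr_ge0 ?(ltW p0)// ltW.
have L_le' : L%:R <= 2 * y / p.
  apply: le_trans L_le _; suff : 1 <= y / p by lra.
  by rewrite ler_pdivlMr//; lra.
have [|D D_ge D_le] := @ex_nat_ceil R ((2 * b + 1) / p ^+ 2).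
  by rewrite divr_ge0 ?exprn_ge0 ?(ltW p0)//; lra.
pose level i := (i.+1 * D)%N.
(* Such a width makes the chance that no sample exceeds level [k] in a window at
   most [expR (- ((b + 1) / p))], negligible against [expR (- (b / p))]. *)
have width_ex k : {H : nat | (b + 1) / (p * (1 - p) ^+ k) <= H%:R <=
    (b + 1) / (p * (1 - p) ^+ k) + 1}.
  have k0 : 0 <= (b + 1) / (p * (1 - p) ^+ k).
    by rewrite divr_ge0 ?mulr_ge0 ?exprn_ge0 ?(ltW p0) ?(ltW q0)//; lra.
  by apply: cid; have [H H1 H2] := ex_nat_ceil k0; exists H; rewrite H1.
pose width i := sval (width_ex (level i)).
have D0 : (0 < D)%N.
  rewrite -(@ltr_nat R); apply: lt_le_trans D_ge; rewrite divr_gt0 ?exprn_gt0//; lra.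
have level_gt0 i : (0 < level i)%N by rewrite muln_gt0.
set W := (b + 1) / p + 1.
have W0 : 0 < W by rewrite /W addr_gt0 ?divr_gt0//; lra.
have W_le : W <= (b + 2) / p.
  rewrite /W; have -> : (b + 2) / p = (b + 1) / p + p^-1 by field; rewrite gt_eqF.
  by rewrite lerD2l.
set Q := (1 - p)^-1 ^+ D.
have Q0 : 0 < Q by rewrite exprn_gt0// invr_gt0.
have Q1 : 1 <= Q by rewrite exprn_ege1// invf_ge1//; lra.
have QV_E : Q^-1 = (1 - p) ^+ D by rewrite /Q exprVn invrK.
have QE i : (1 - p) ^+ level i = Q^-1 ^+ i.+1 by rewrite QV_E -exprM mulnC.
(* Each of the windows before window [i] has length at most [W * Q ^+ i]. *)
have start_le i : (start width i)%:R <= i%:R * W * Q ^+ i.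
  elim: i => [|i IH] /=; first by rewrite mul0r mul0r.
  have -> : i.+1%:R * W * Q ^+ i.+1 = i%:R * W * Q ^+ i.+1 + W * Q ^+ i.+1.
    by rewrite -natr1; ring.
  rewrite natrD; apply: lerD.
    apply: le_trans IH _; rewrite ler_wpM2l ?mulr_ge0 ?(ltW W0)//.
    by rewrite exprS ler_peMl// exprn_ge0// ltW.
  rewrite /width; case: (width_ex _) => H /= /andP[_ /le_trans]; apply.
  have -> : W * Q ^+ i.+1 = (b + 1) / p * Q ^+ i.+1 + Q ^+ i.+1 by rewrite /W; ring.
  rewrite QE exprVn; apply: lerD; last by rewrite exprn_ege1.
  by rewrite invfM invrK mulrA.
exists (start width L); last first.
  apply: le_trans (pr_late_le hX width level_gt0 L) _.
  rewrite mulrDl; apply: lerD.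
    (* The mass [y^-1 / 8] of [block_mass_ge], less the truncation to the window. *)
    have g_ge i : y^-1 / 16 <= trial_mass p X (level i) (level i) (width i).
      have := block_mass_ge p01 (leqnn (level i)); have p2 : p <= 2^-1 by lra.
      move=> /(_ p2); rewrite -/y expRN -/y => u_ge.
      have := block_mass_le_trial p01 hX (width i) (leqnn (level i)).
      have tail : (1 - (1 - p) ^+ level i) ^+ width i <= y^-1 / 16.
        have qk : 0 < (1 - p) ^+ level i < 1.
          by rewrite exprn_gt0//= exprn_ilt1 ?(ltW q0)// -?lt0n//; lra.
        apply: le_trans (expr1B_le _ qk) _.
        apply: (@le_trans _ _ (expR (- ((b + 1) / p)))).
          rewrite ler_expR lerN2 /width; case: (width_ex _) => H /= /andP[+ _].
          by rewrite ler_pdivrMr ?mulr_gt0 ?exprn_gt0// => ?; rewrite ler_pdivrMr//; lra.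
        rewrite mulrDl opprD expRD -/y expRN -/y ler_wpM2l ?invr_ge0 ?(ltW y0)//.
        by rewrite div1r; apply: le_trans (expRN1V_le p0) _; lra.
      by move: u_ge tail; lra.
    have g01 i : 0 <= 1 - trial_mass p X (level i) (level i) (width i) <= expR (- (y^-1 / 16)).
      apply/andP; split; last first.
        by apply: le_trans (expR_ge1Dx _); rewrite lerD2l lerN2.
      have [[m1 _] E1] := pr_all_fail hX (fun=> level i) (fun=> width i) 1.
      by move: E1; rewrite big_ord1 => <-; exact: pr_ge0.
    apply: (@le_trans _ _ (\prod_(i < L) expR (- (y^-1 / 16)))).
      by apply: ler_prod => i _; exact: g01.
    rewrite prodr_const card_ord -expRM_natl.
    have p160 : 0 < 16 * p by lra.
    apply: le_trans (expRN1V_le p160); rewrite ler_expR mulrN lerN2 invfM.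
    apply: (@le_trans _ _ (y / p * (y^-1 / 16))).
      by rewrite le_eqVlt; apply/orP; left; apply/eqP; field; rewrite !gt_eqF.
    by apply: ler_wpM2r => //; rewrite divr_ge0// invr_ge0 ltW.
  have QV : Q^-1 <= expR (- ((2 * b + 1) / p)).
    rewrite QV_E; apply: le_trans (expr1B_le D p01) _.
    rewrite ler_expR lerN2; apply: (@le_trans _ _ (p * ((2 * b + 1) / p ^+ 2))).
      by rewrite le_eqVlt; apply/orP; left; apply/eqP; field; rewrite gt_eqF.
    by rewrite ler_pM2l.
  have term (i : 'I_L) : (start width i)%:R * (1 - p) ^+ level i <= L%:R * W * Q^-1.
    rewrite QE; apply: (@le_trans _ _ (i%:R * W * Q ^+ i * Q^-1 ^+ i.+1)).
      by apply: ler_wpM2r; [rewrite exprn_ge0// invr_ge0 ltW|exact: start_le].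
    have -> : i%:R * W * Q ^+ i * Q^-1 ^+ i.+1 = i%:R * W * Q^-1.
      rewrite [Q^-1 ^+ _]exprS exprVn; field.
      by rewrite (expf_neq0 i (lt0r_neq0 Q0)) lt0r_neq0.
    apply: ler_wpM2r; first by rewrite invr_ge0 ltW.
    by apply: ler_wpM2r; [exact: ltW|rewrite ler_nat ltnW].
  apply: (@le_trans _ _ (\sum_(i < L) L%:R * W * Q^-1)).
    by apply: ler_sum => i _.
  rewrite sumr_const card_ord -[leLHS]mulr_natl.
  apply: (@le_trans _ _ ((2 * y / p) * ((2 * y / p) * ((b + 2) / p) * (expR (- (b / p)) * expR (- (b / p)) * (24 * p ^+ 4))))).
    have L0 : 0 <= L%:R :> R by [].
    apply: ler_pM => //; first by rewrite !mulr_ge0 ?invr_ge0 ?(ltW W0) ?(ltW Q0).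
    apply: ler_pM; rewrite ?invr_ge0 ?(ltW Q0) ?mulr_ge0 ?(ltW W0)//.
      by apply: ler_pM => //; exact: ltW.
    apply: le_trans QV _.
    have -> : - ((2 * b + 1) / p) = - (b / p) + - (b / p) + - (1 / p) by field;
      rewrite gt_eqF.
    rewrite !expRD ler_wpM2l ?mulr_ge0 ?expR_ge0//.
    by have := expR_decay 3 ltr01 p0; rewrite expr1n divr1.
  rewrite expRN -/y le_eqVlt; apply/orP; left; apply/eqP.
  by field; rewrite !gt_eqF.
apply: le_lt_trans (start_le L) _.
set h := - ln (1 - p).
have hp : (1 - p) * h <= p := lograte_le p01.
have h2 : h <= 2 * p.
  have hq : 2^-1 * h <= (1 - p) * h.
    apply: ler_wpM2r; last by lra.
    by apply: le_trans (le_lograte p01); exact: ltW.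
  by move: hp hq; lra.
have -> : Q ^+ L = expR (L%:R * (D%:R * h)).
  by rewrite /Q !expRM_natl /h expRN lnK// posrE.
apply: (@lt_le_trans _ _ (expR (L%:R * W) * expR (L%:R * (D%:R * h)))).
  by rewrite ltr_pM2r ?expR_gt0//; have := expR_ge1Dx (L%:R * W); lra.
rewrite -expRD ler_expR -mulrDr.
have DE : D%:R * h <= (4 * b + 4) / p.
  apply: (@le_trans _ _ (((2 * b + 1) / p ^+ 2 + 1) * (2 * p))).
    apply: ler_pM => //.
    by apply: le_trans (le_lograte p01); exact: ltW.
  rewrite ler_pdivlMr//.
  have -> : ((2 * b + 1) / p ^+ 2 + 1) * (2 * p) * p = 2 * (2 * b + 1) + 2 * p ^+ 2.
    by field; rewrite gt_eqF.
  have : p ^+ 2 <= 1 by rewrite exprn_ile1// ltW.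
  by lra.
apply: (@le_trans _ _ ((2 * y / p) * ((5 * b + 6) / p))).
  apply: ler_pM => //.
    rewrite addr_ge0 ?(ltW W0)// mulr_ge0//.
    by apply: le_trans (le_lograte p01); exact: ltW.
  have -> : (5 * b + 6) / p = (b + 2) / p + (4 * b + 4) / p.
    by field; rewrite gt_eqF.
  exact: lerD.
rewrite [(b + e) / p]mulrDl expRD -/y.
have -> : 2 * y / p * ((5 * b + 6) / p) = y * (B / p ^+ 2).
  by rewrite /B; field; rewrite gt_eqF.
apply: ler_wpM2l; first exact: ltW.
have := expR_decay 2 e0 p0; rewrite expRN => dec.
rewrite -[leRHS]invrK -[leLHS]invrK lef_pV2 ?posrE ?invr_gt0 ?expR_gt0 ?divr_gt0 ?exprn_gt0//.
apply: le_trans dec _; rewrite -[3`!%:R]/(6%:R : R).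
have B60 : 0 < 6 * B by apply: mulr_gt0.
rewrite ltr_pdivlMr// in pe.
have -> : (B / p ^+ 2)^-1 = p ^+ 2 * B^-1 by field; rewrite !gt_eqF.
have -> : 6 / e ^+ 3 * p ^+ 3 = p ^+ 2 * (6 * p / e ^+ 3) by field; rewrite gt_eqF.
apply: ler_wpM2l; first by rewrite exprn_ge0// ltW.
rewrite ler_pdivrMr ?exprn_gt0// (mulrC B^-1) ler_pdivlMr//.
by move: pe; lra.
Qed.

End tail_bounds.

(** * Convergence in probability *)

Lemma loglog_window (R : realType) (p e l : R) n : 0 < p ->
  expR (expR ((l - e) / p)) < n%:R -> n%:R < expR (expR ((l + e) / p)) ->
  (`|p%:E * lne (lne n%:R%:E) - l%:E| < e%:E)%E.
Proof.
move=> p0 lo hi; have n0 : 0 < n%:R :> R by apply: lt_trans lo; exact: expR_gt0.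
have lo1 : expR ((l - e) / p) < ln n%:R by rewrite -ltr_expR lnK.
have hi1 : ln n%:R < expR ((l + e) / p) by rewrite -ltr_expR lnK.
have ln0 : 0 < ln n%:R :> R by apply: lt_trans lo1; exact: expR_gt0.
have lo2 : (l - e) / p < ln (ln n%:R) by rewrite -ltr_expR lnK.
have hi2 : ln (ln n%:R) < (l + e) / p by rewrite -ltr_expR lnK.
rewrite !lne_EFin// -EFinM -EFinB/= lte_fin ltr_distl.
by rewrite ltr_pdivrMr// in lo2; rewrite ltr_pdivlMr// in hi2; lra.
Qed.

Theorem theorem3 (R : realType)
  (d : R -> measure_display)
  (T : forall p : R, measurableType (d p))
  (P : forall p : R, probability (T p) R)
  (X : forall p : R, nat -> {RV (P p) >-> nat})
  (hX : forall p : R, 0 < p < 1 -> iid_geometric p (X p)) :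
  cvg_in_probability (0 : R)^'+ P
    (fun p w =>
       (p%:E * lne (lne (block_samples R (fun n => X p n w))))%E)
    (limit_constant R).
Proof.
move=> eps eps0; set b := limit_constant R.
have b0 : 0 < b := limit_constant_gt0 R.
(* [early_tail] wants a nonnegative exponent [b - e]. *)
set e := Num.min eps b.
have e0 : 0 < e by rewrite lt_min eps0.
have eb : e <= b by rewrite ge_min lexx orbT.
have [c1 [p1 [p10 early_le]]] := early_tail e0 eb.
have [c2 [p2 [p20 late_le]]] := late_tail e0.
have bound p : 0 < p < 1 -> p < p1 -> p < p2 ->
    (P p [set w | (eps%:E <= `|p%:E * lne (lne (block_samples R (fun n => X p n w))) - b%:E|)%E]
      <= ((c1 + c2) * p)%:E)%E.
  move=> p01 pp1 pp2; have [p0 _] := andP p01; have iid := hX p p01.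
  set E := mkset _; set E1 := expR (expR ((b - e) / p)).
  have [M2 M2_lt late2] := late_le p p01 pp2 _ _ _ _ iid.
  have M1_le : (Num.truncn E1)%:R <= E1 by rewrite truncn_le expR_ge0.
  have early1 := early_le p p01 pp1 _ _ _ _ iid _ M1_le.
  have mE : measurable E := measurable_block_samples (X p)
    [set y | (eps%:E <= `|p%:E * lne (lne y) - b%:E|)%E].
  have m1 : measurable (early (X p) (Num.truncn E1)).
    exact: (measurable_block_samples (X p) [set y | (y <= (Num.truncn E1)%:R%:E)%E]).
  have m2 : measurable (late (X p) M2).
    exact: (measurable_block_samples (X p) [set y | (M2%:R%:E < y)%E]).
  have sub : E `<=` early (X p) (Num.truncn E1) `|` late (X p) M2.
    move=> w; rewrite /E /early /late/=.
    case: (block_samples_cases R (fun n => X p n w)) => [[-> _]|[n [_ _ ->]]] Ew.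
      by right; rewrite ltry.
    rewrite lee_fin lte_fin !ler_nat ltr_nat.
    have [|nM1] := leqP n (Num.truncn E1); first by left.
    have [nM2|] := leqP n M2; last by right.
    suff : (`|p%:E * lne (lne n%:R%:E) - b%:E| < e%:E)%E.
      by move/(le_lt_trans Ew); rewrite lte_fin lt_min ltxx.
    apply: loglog_window => //.
      by apply: lt_le_trans (truncnS_gt E1) _; rewrite ler_nat.
    by apply: le_lt_trans M2_lt; rewrite ler_nat.
  rewrite (prE (P p) mE) lee_fin.
  apply: le_trans (pr_le (P p) mE (measurableU _ _ m1 m2) sub) _.
  apply: le_trans (pr_le_setU (P p) m1 m2) _.
  by rewrite mulrDl lerD.
apply: (squeeze_cvge (f := cst 0%E) (h := fun p : R => ((c1 + c2) * p)%:E)).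
- near=> p; rewrite measure_ge0/=; apply: bound; first (apply/andP; split).
  + near: p; exact: nbhs_right_gt.
  + near: p; exact: nbhs_right_lt.
  + near: p; exact: nbhs_right_lt.
  + near: p; exact: nbhs_right_lt.
- exact: cvg_cst.
- apply: cvg_EFin; first by near=> p.
  rewrite -[X in _ --> X](mulr0 (c1 + c2)).
  by apply/cvg_at_right_filter; apply: cvgMr.
Unshelve. all: by end_near. Qed.
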